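(* Let $\cong$ be a congruence on LTSs such that $L\doteq L'$ implies $L\cong L'$ and $V\cong B$. Then: (1) if $\cong$ preserves $\mathit{anF}$ and $\mathit{minD}$ but does not preserve $\mathit{Tr}$, then $\cong$ is the equivalence induced by $\Sigma,\mathit{anF},\mathit{minD},\mathit{anI}$; (2) if $\cong$ preserves $\mathit{Tr},\mathit{anF},\mathit{minD}$ but preserves neither $\mathit{Div}$ nor $\mathit{Inf}$, then $\cong$ is the equivalence induced by $\Sigma,\mathit{Tr},\mathit{anF},\mathit{minD},\mathit{anI}$; (3) if $\cong$ preserves $\mathit{anF},\mathit{minD},\mathit{Inf}$ but does not preserve $\mathit{Div}$, then $\cong$ is the equivalence induced by $\Sigma,\mathit{Tr},\mathit{anF},\mathit{minD},\mathit{Inf}$; (4) if $\cong$ preserves $\mathit{anF}$ and $\mathit{Div}$ but preserves neither $\mathit{snF}$ nor $\mathit{aenI}$, then $\cong$ is the equivalence induced by $\Sigma,\mathit{Tr},\mathit{anF},\mathit{Div},\mathit{eanI}$; (5) if $\cong$ preserves $\mathit{anF},\mathit{Div},\mathit{aenI}$ but preserves neither $\mathit{snF}$ nor $\mathit{Inf}$, then $\cong$ is the equivalence induced by $\Sigma,\mathit{Tr},\mathit{anF},\mathit{Div},\mathit{aenI}$; (6) if $\cong$ preserves $\mathit{anF},\mathit{Div},\mathit{Inf}$ but does not preserve $\mathit{snF}$, then $\cong$ is the equivalence induced by $\Sigma,\mathit{Tr},\mathit{anF},\mathit{Div},\mathit{Inf}$.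
   Context: An LTS is a tuple $L=(S,\Sigma,\Delta,\hat s)$ with states $S$, alphabet $\Sigma$ (possibly infinite), $\tau\notin\Sigma$ a reserved invisible action, transitions $\Delta\subseteq S\times(\Sigma\cup\{\tau\})\times S$, initial state $\hat s$; $\Sigma(L)$ denotes the alphabet. Operators: action prefix $a.L$ ($a\neq\tau$): new initial state $\hat s'$, alphabet $\Sigma\cup\{a\}$, transitions $\Delta\cup\{(\hat s',a,\hat s)\}$. Hiding $L\setminus A$: alphabet $\Sigma\setminus A$, each transition labelled by an element of $A$ relabelled $\tau$, otherwise unchanged. Relational renaming $L\Phi$ ($\Phi$ a set of pairs, $\tau$ not in its domain $\mathcal D(\Phi)$ or range; $\Phi(a,b)$ means $(a,b)\in\Phi$ or $a=b\notin\mathcal D(\Phi)$): alphabet $\{b\mid\exists a\in\Sigma:\Phi(a,b)\}$, transitions $\{(s,b,s')\mid\exists a:(s,a,s')\in\Delta\wedge\Phi(a,b)\}$, same states and initial state. Parallel composition $L_1\|L_2$: states $S_1\times S_2$, alphabet $\Sigma_1\cup\Sigma_2$, initial $(\hat s_1,\hat s_2)$; actions in $\Sigma_1\cap\Sigma_2$ are taken jointly by both components, all other actions (including $\tau$) by one component while the other stays put. A congruence is an equivalence $\cong$ with $L\cong L'\Rightarrow a.L\cong a.L',\ L\setminus A\cong L'\setminus A,\ L\Phi\cong L'\Phi,\ L\|L''\cong L'\|L'',\ L''\|L\cong L''\|L'$. For $\sigma=a_1\cdots a_n\in\Sigma^*$, $s\stackrel{\sigma}{\Rightarrow}s'$ means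 a finite path from $s$ to $s'$ whose non-$\tau$ labels are exactly $a_1,\dots,a_n$ in order; $\hat s\stackrel{\xi}{\Rightarrow}$ for $\xi\in\Sigma^\omega$ means an infinite path from $\hat s$ whose non-$\tau$ label sequence is $\xi$; $s\stackrel{\tau^\omega}{\to}$ means an infinite path of $\tau$-transitions from $s$. Define $\mathit{Tr}(L)=\{\sigma\in\Sigma^*\mid\exists s:\hat s\stackrel\sigma\Rightarrow s\}$, $\mathit{Div}(L)=\{\sigma\in\Sigma^*\mid\exists s:\hat s\stackrel\sigma\Rightarrow s\wedge s\stackrel{\tau^\omega}\to\}$, $\mathit{Inf}(L)=\{\xi\in\Sigma^\omega\mid\hat s\stackrel\xi\Rightarrow\}$, $\mathit{Sf}(L)=\{(\sigma,A)\in\Sigma^*\times2^\Sigma\mid\exists s:\hat s\stackrel\sigma\Rightarrow s\wedge\forall a\in A\cup\{\tau\}\,\forall s':(s,a,s')\notin\Delta\}$. Further: $\mathit{minD}(L)=\{a_1\cdots a_n\in\mathit{Div}(L)\mid\forall i,0\le i<n: a_1\cdots a_i\notin\mathit{Div}(L)\}$; $\mathit{extT}(L)=\{a_1\cdots a_n\in\Sigma(L)^*\mid\exists i,0\le i\le n: a_1\cdots a_i\in\mathit{minD}(L)\}$; $\mathit{extI}(L)=\{a_1a_2\cdots\in\Sigma(L)^\omega\mid\exists i\ge0: a_1\cdots a_i\in\mathit{minD}(L)\}$; $\mathit{anI}(L)=\mathit{Inf}(L)\setminus\mathit{extI}(L)$; $\mathit{eanI}(L)=\{a_1a_2\cdots\in\mathit{Inf}(L)\mid\exists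 n\ge0\,\forall i\ge n: a_1\cdots a_i\notin\mathit{Div}(L)\}$; $\mathit{aenI}(L)=\{a_1a_2\cdots\in\mathit{Inf}(L)\mid\forall n\ge0\,\exists i\ge n: a_1\cdots a_i\notin\mathit{Div}(L)\}$; $\mathit{nF}(L)=\{(\sigma,A)\in\mathit{Sf}(L)\mid\sigma\notin\mathit{Div}(L)\}$; $\mathit{snF}(L)=\{(\sigma,A)\in\mathit{nF}(L)\mid\forall a\in A:\sigma a\notin\mathit{Div}(L)\}$; $\mathit{anF}(L)=\{(\sigma,A)\in\mathit{Sf}(L)\mid\sigma\notin\mathit{extT}(L)\}$. $L\doteq L'$ (CFFD-equivalence) iff $\Sigma,\mathit{Sf},\mathit{Div},\mathit{Inf}$ all agree on $L$ and $L'$. An equivalence preserves $X$ if $L\cong L'\Rightarrow X(L)=X(L')$; the equivalence induced by $\Sigma,X_1,\dots,X_k$ relates $L,L'$ iff all these functions agree on them. $V$ is the one-state LTS with empty alphabet and a single $\tau$ self-loop; $B$ is the LTS with empty alphabet, states $s_0$ (initial) and $s_1$, and transitions $(s_0,\tau,s_0)$, $(s_0,\tau,s_1)$. *)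

(* Defs.v *)
From mathcomp Require Import all_boot.
From mathcomp Require Import boolp classical_sets functions cardinality.
From Stdlib Require List RelationClasses.

Set Implicit Arguments.
Unset Strict Implicit.
Unset Printing Implicit Defensive.

Local Open Scope classical_set_scope.

(* [Act] is the universe of visible action names, and alphabets are arbitrary
   subsets of it.  A transition label is an [option Act], where [None] is the
   invisible action tau; hence tau belongs to no alphabet, to no hidden set and
   to neither side of any renaming. *)
Record LTS (Act : Type) := MkLTS {
  state : Type;
  alphabet : set Act;
  trans : state -> option Act -> state -> Prop;
  init : state;
  trans_alphabet : forall s a s', trans s (Some a) s' -> alphabet a
}.

Section Operators.
Variable Act : Type.
Implicit Types (L : LTS Act) (A : set Act) (a : Act).

(* a.L; the new initial state is [None]. *)
Section Prefix.
Variables (a : Act) (L : LTS Act).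

Definition prefix_trans (s : option (state L)) (x : option Act)
    (s' : option (state L)) : Prop :=
  match s, s' with
  | Some t, Some t' => trans t x t'
  | None, Some t' => x = Some a /\ t' = init L
  | _, None => False
  end.

Lemma prefix_trans_alphabet s b s' :
  prefix_trans s (Some b) s' -> (alphabet L `|` [set a]) b.
Proof.
case: s s' => [s|] [s'|] //=; first by move=> h; left; exact: (trans_alphabet h).
by case=> -[->] _; right.
Qed.

Definition act_prefix : LTS Act :=
  @MkLTS Act (option (state L)) (alphabet L `|` [set a]) prefix_trans None
    prefix_trans_alphabet.
End Prefix.

Section Hide.
Variables (L : LTS Act) (A : set Act).

Definition hide_label_rel (x y : option Act) : Prop :=
  match x with
  | Some a => (A a /\ y = None) \/ (~ A a /\ y = Some a)
  | None => y = None
  end.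

Definition hide_trans (s : state L) (y : option Act) (s' : state L) : Prop :=
  exists x, trans s x s' /\ hide_label_rel x y.

Lemma hide_trans_alphabet s b s' :
  hide_trans s (Some b) s' -> (alphabet L `\` A) b.
Proof.
case=> -[a|] [h] //= [[]//|[naA [->]]].
by split=> //; exact: (trans_alphabet h).
Qed.

Definition hiding : LTS Act :=
  @MkLTS Act (state L) (alphabet L `\` A) hide_trans (init L)
    hide_trans_alphabet.
End Hide.

Section Rename.
Variables (L : LTS Act) (Phi : set (Act * Act)).

(* Actions outside the domain of Phi are kept. *)
Definition renames (a b : Act) : Prop :=
  Phi (a, b) \/ (a = b /\ ~ exists c, Phi (a, c)).

Definition rename_trans (s : state L) (y : option Act) (s' : state L) : Prop :=
  match y with
  | Some b => exists a, trans s (Some a) s' /\ renames a b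
  | None => trans s None s'
  end.

Definition rename_alphabet : set Act :=
  [set b | exists a, alphabet L a /\ renames a b].

Lemma rename_trans_alphabet s b s' :
  rename_trans s (Some b) s' -> rename_alphabet b.
Proof. by case=> a [h ab]; exists a; split=> //; exact: (trans_alphabet h). Qed.

Definition rename : LTS Act :=
  @MkLTS Act (state L) rename_alphabet rename_trans (init L)
    rename_trans_alphabet.
End Rename.

Section Parallel.
Variables (L1 L2 : LTS Act).

Definition shared (x : option Act) : Prop :=
  if x is Some a then alphabet L1 a /\ alphabet L2 a else False.

Definition par_trans (s : state L1 * state L2) (x : option Act)
    (s' : state L1 * state L2) : Prop :=
  [\/ [/\ shared x, trans s.1 x s'.1 & trans s.2 x s'.2],
      [/\ ~ shared x, trans s.1 x s'.1 & s'.2 = s.2]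
    | [/\ ~ shared x, s'.1 = s.1 & trans s.2 x s'.2]].

Lemma par_trans_alphabet s b s' :
  par_trans s (Some b) s' -> (alphabet L1 `|` alphabet L2) b.
Proof.
case=> -[_].
- by move=> h _; left; exact: (trans_alphabet h).
- by move=> h _; left; exact: (trans_alphabet h).
- by move=> _ h; right; exact: (trans_alphabet h).
Qed.

Definition par : LTS Act :=
  @MkLTS Act (state L1 * state L2)%type (alphabet L1 `|` alphabet L2)
    par_trans (init L1, init L2) par_trans_alphabet.
End Parallel.

End Operators.

Section Semantics.
Variables (Act : Type) (L : LTS Act).
Implicit Types (s : state L) (sigma : seq Act) (xi : nat -> Act) (A : set Act).

Fixpoint run s (w : seq (option Act)) s' : Prop :=
  if w is x :: w' then exists s1, trans s x s1 /\ run s1 w' s' else s = s'.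

Definition visible (w : seq (option Act)) : seq Act := pmap id w.

(* s =sigma=> s' *)
Definition weak s sigma s' : Prop :=
  exists w, run s w s' /\ visible w = sigma.

(* s =xi=> for infinite xi: [pos] enumerates, in increasing order, exactly the
   positions of the visible labels along the path. *)
Definition weak_inf s xi : Prop :=
  exists (p : nat -> state L) (lab : nat -> option Act) (pos : nat -> nat),
    [/\ p 0 = s,
        forall i, trans (p i) (lab i) (p i.+1),
        forall j k, j < k -> pos j < pos k,
        forall k, lab (pos k) = Some (xi k)
      & forall i, lab i <> None -> exists k, i = pos k].

Definition diverges s : Prop :=
  exists p : nat -> state L,
    p 0 = s /\ forall i, trans (p i) None (p i.+1).

Definition word sigma : Prop := List.Forall (alphabet L) sigma.
Definition omega_word xi : Prop := forall i, alphabet L (xi i).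

(* a_1 ... a_i, for an infinite sequence whose entry a_{i+1} is [xi i] *)
Definition prefix_of xi (i : nat) : seq Act := mkseq xi i.

Definition Tr : set (seq Act) :=
  [set sigma | word sigma /\ exists s, weak (init L) sigma s].

Definition Div : set (seq Act) :=
  [set sigma | word sigma /\ exists s, weak (init L) sigma s /\ diverges s].

Definition Inf : set (nat -> Act) :=
  [set xi | omega_word xi /\ weak_inf (init L) xi].

Definition Sf : set (seq Act * set Act) :=
  [set f | [/\ word f.1, f.2 `<=` alphabet L
    & exists s, [/\ weak (init L) f.1 s,
        forall s', ~ trans s None s'
      & forall a, f.2 a -> forall s', ~ trans s (Some a) s']]].

Definition minD : set (seq Act) :=
  [set sigma | Div sigma /\ forall i, i < size sigma -> ~ Div (take i sigma)].

Definition extT : set (seq Act) :=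
  [set sigma | word sigma /\ exists i, i <= size sigma /\ minD (take i sigma)].

Definition extI : set (nat -> Act) :=
  [set xi | omega_word xi /\ exists i, minD (prefix_of xi i)].

Definition anI : set (nat -> Act) := Inf `\` extI.

Definition eanI : set (nat -> Act) :=
  [set xi | Inf xi /\ exists n, forall i, n <= i -> ~ Div (prefix_of xi i)].

Definition aenI : set (nat -> Act) :=
  [set xi | Inf xi /\ forall n, exists i, n <= i /\ ~ Div (prefix_of xi i)].

Definition nF : set (seq Act * set Act) :=
  [set f | Sf f /\ ~ Div f.1].

Definition snF : set (seq Act * set Act) :=
  [set f | nF f /\ forall a, f.2 a -> ~ Div (rcons f.1 a)].

Definition anF : set (seq Act * set Act) :=
  [set f | Sf f /\ ~ extT f.1].

End Semantics.

Section Equivalences.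
Variable Act : Type.

Definition cffd_equiv (L L' : LTS Act) : Prop :=
  [/\ alphabet L = alphabet L', Sf L = Sf L', Div L = Div L' & Inf L = Inf L'].

Record congruence (cong : LTS Act -> LTS Act -> Prop) : Prop := {
  congruence_equiv : RelationClasses.Equivalence cong;
  congruence_prefix : forall a L L',
    cong L L' -> cong (act_prefix a L) (act_prefix a L');
  congruence_hide : forall A L L',
    cong L L' -> cong (hiding L A) (hiding L' A);
  congruence_rename : forall Phi L L',
    cong L L' -> cong (rename L Phi) (rename L' Phi);
  congruence_parl : forall L'' L L',
    cong L L' -> cong (par L L'') (par L' L'');
  congruence_parr : forall L'' L L',
    cong L L' -> cong (par L'' L) (par L'' L')
}.

Definition preserves (cong : LTS Act -> LTS Act -> Prop) (T : Type)
    (X : LTS Act -> T) : Prop :=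
  forall L L', cong L L' -> X L = X L'.

Definition V_trans (s : unit) (x : option Act) (s' : unit) : Prop := x = None.

Lemma V_trans_alphabet s a s' : V_trans s (Some a) s' -> (@set0 Act) a.
Proof. by []. Qed.

Definition V : LTS Act := @MkLTS Act unit set0 V_trans tt V_trans_alphabet.

(* s_0 is [false] and s_1 is [true]. *)
Definition B_trans (s : bool) (x : option Act) (s' : bool) : Prop :=
  s = false /\ x = None.

Lemma B_trans_alphabet s a s' : B_trans s (Some a) s' -> (@set0 Act) a.
Proof. by case. Qed.

Definition B : LTS Act := @MkLTS Act bool set0 B_trans false B_trans_alphabet.

End Equivalences.

Arguments V {Act}.
Arguments B {Act}.

(* Main.v *)
(* Every case has the shape: if the listed semantic sets of L and L' agree, then
   L ~ L'.  For this L is shown congruent to a saturated version of itself whose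
   full semantics depends on the listed sets only.  The saturated version is
   C[K] for a context C built from L, where K ~ K' witness a property that is
   not preserved: C follows L; once L diverges after a trace r, it may start K in
   the background, let it silently perform a chosen trace, and then continue in a
   second phase.  Everything that K itself may do before that happens at the
   divergent trace r, where by V ~ B the stable failures do not matter.  The
   second phase is chosen such that C[K'] adds nothing to L, while C[K] adds
   - chaos, if K' lacks the chosen trace (Tr is not preserved),
   - divergence, if K but not K' diverges after it (Div),
   - deadlock, if K but not K' may refuse a set A after it (snF); the second
     phase is then a copy of L that may insist on A at any moment,
   - infinite traces, if the chosen trace grows along an infinite trace of K that
     is not one of K' (Inf, aenI), one step at each visited divergent trace of L.
   Conversely, Tr, anI and eanI are preserved because hiding L next to an LTS
   that dictates a finite or infinite trace turns the possibility of this trace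
   into a divergence (or, for Tr, also into an infinite trace). *)
Require Import Defs.
From mathcomp Require Import all_boot.
From mathcomp Require Import boolp classical_sets functions cardinality.
From Stdlib Require List.

Set Implicit Arguments.
Unset Strict Implicit.
Unset Printing Implicit Defensive.

Local Open Scope classical_set_scope.

(** * Runs of a labelled transition system *)

Definition lbl (T : Type) (x : option T) : seq T :=
  if x is Some a then [:: a] else [::].

Lemma dependent_choice (T : Type) (R : T -> T -> Prop) (G : T -> Prop) x0 :
  (forall x, G x -> exists y, R x y /\ G y) -> G x0 ->
  exists f : nat -> T, [/\ f 0 = x0, forall i, R (f i) (f i.+1) & forall i, G (f i)].
Proof.
move=> Rnext Gx0.
have /choice[h hP] : forall x, exists y, G x -> R x y /\ G y.
  by move=> x; have [/Rnext[y ?]|nGx] := EM (G x); [exists y | exists x].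
have Giter i : G (iter i h x0) by elim: i => //= i /hP[].
by exists (fun i => iter i h x0); split=> // i /=; have [] := hP _ (Giter i).
Qed.

Lemma infinitely_often_seq (P : nat -> Prop) : (forall m, exists i, m <= i /\ P i) ->
  exists n : nat -> nat, (forall k, n k < n k.+1) /\ forall k, P (n k).
Proof.
move=> /choice[f fP]; pose n k := iter k (fun m => f m.+1) (f 0); exists n.
by split=> [k|[|k]]; [have [] := fP (n k).+1|have [] := fP 0|have [] := fP (n k).+1].
Qed.

Lemma increasing_ge (n : nat -> nat) : (forall k, n k < n k.+1) -> forall k, k <= n k.
Proof. by move=> nS; elim=> // k IH; exact: leq_ltn_trans IH (nS k). Qed.

Lemma prefix_ofS (T : Type) (xi : nat -> T) i :
  prefix_of xi i.+1 = rcons (prefix_of xi i) (xi i).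
Proof. by rewrite /prefix_of /mkseq -addn1 iotaD map_cat cats1. Qed.

Lemma size_prefix_of (T : Type) (xi : nat -> T) i : size (prefix_of xi i) = i.
Proof. exact: size_mkseq. Qed.

Lemma take_prefix_of (T : Type) (xi : nat -> T) i j :
  i <= j -> take i (prefix_of xi j) = prefix_of xi i.
Proof. by move=> ij; rewrite /prefix_of -map_take take_iota (minn_idPl ij). Qed.

Lemma prefix_ofD (T : Type) (xi : nat -> T) m n :
  prefix_of xi (m + n) = prefix_of xi m ++ prefix_of (fun j => xi (m + j)) n.
Proof.
by elim: n => [|n IHn]; rewrite ?addn0 ?cats0 // addnS !prefix_ofS IHn -rcons_cat.
Qed.

Lemma prefix_of_split (T : Type) (xi : nat -> T) i j : i <= j ->
  prefix_of xi j = prefix_of xi i ++ prefix_of (fun k => xi (i + k)) (j - i).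
Proof. by move=> /subnKC {1}<-; rewrite prefix_ofD. Qed.

Lemma prefix_of_step (T : Type) (xi : nat -> T) i :
  prefix_of (fun j => xi (i + j)) (i.+1 - i) = [:: xi i].
Proof. by rewrite subSnn /prefix_of /mkseq /= addn0. Qed.

Section Runs.
Variables (Act : Type) (L : LTS Act).
Implicit Types (s t : state L) (u v : seq Act) (x : option Act) (xi : nat -> Act).

Lemma visible_cons x (w : seq (option Act)) : visible (x :: w) = lbl x ++ visible w.
Proof. by case: x. Qed.

Lemma run_cat s w1 w2 t :
  run s (w1 ++ w2) t <-> exists r, run s w1 r /\ run r w2 t.
Proof.
elim: w1 s => [|x w1 IH] s /=; first by split=> [?|[r [->]]] //; exists s.
split=> [[s1 [s1x /IH[r [? ?]]]]|[r [[s1 [? ?]] ?]]].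
  by exists r; split=> //; exists s1.
by exists s1; split=> //; apply/IH; exists r.
Qed.

Lemma weak0 s : weak s [::] s.
Proof. by exists [::]. Qed.

Lemma weak_cat s u r v t : weak s u r -> weak r v t -> weak s (u ++ v) t.
Proof.
move=> [w1 [r1 <-]] [w2 [r2 <-]]; exists (w1 ++ w2); split; last exact: pmap_cat.
by apply/run_cat; exists r.
Qed.

Lemma weak1 s x t : trans s x t -> weak s (lbl x) t.
Proof.
by move=> sxt; exists [:: x]; split; [exists t | rewrite visible_cons cats0].
Qed.

Lemma weak_tau s t : trans s None t -> weak s [::] t. Proof. exact: weak1. Qed.

Lemma weak_act s a t : trans s (Some a) t -> weak s [:: a] t. Proof. exact: weak1. Qed.

Lemma weak_cons s x r v t : trans s x r -> weak r v t -> weak s (lbl x ++ v) t.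
Proof. by move=> /weak1; apply: weak_cat. Qed.

Lemma weak_tau_l s r v t : trans s None r -> weak r v t -> weak s v t.
Proof. exact: weak_cons. Qed.

Lemma weak_tau_r s u r t : weak s u r -> trans r None t -> weak s u t.
Proof. by move=> sr /weak_tau rt; rewrite -(cats0 u); exact: weak_cat sr rt. Qed.

Lemma weak_rcons s u r x t : weak s u r -> trans r x t -> weak s (u ++ lbl x) t.
Proof. by move=> su /weak1; apply: weak_cat su. Qed.

Lemma weak_ind_l (P : state L -> seq Act -> Prop) t :
  P t [::] ->
  (forall s x r u, trans s x r -> weak r u t -> P r u -> P s (lbl x ++ u)) ->
  forall s u, weak s u t -> P s u.
Proof.
move=> P0 Pc s _ [w [sw <-]]; elim: w s sw => [|x w IH] s /=; first by move=> ->.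
move=> [r [sxr rw]].
have := Pc s x r (visible w) sxr (ex_intro _ w (conj rw erefl)) (IH _ rw).
by case: x sxr.
Qed.

(** All reachability arguments about contexts use this induction; [J] sees the visible trace shown
    so far, so a state can be related to the trace leading to it. *)
Lemma weak_invariant (J : seq Act -> state L -> Prop) :
  (forall u s x t, J u s -> trans s x t -> J (u ++ lbl x) t) ->
  forall u s v t, J u s -> weak s v t -> J (u ++ v) t.
Proof.
move=> Jnext u s v t + h.
pose P s v := forall u, J u s -> J (u ++ v) t; suff H : P s v by exact: H.
move: s v h {u}; apply: weak_ind_l => [u|]; first by rewrite cats0.
by move=> s x r v sxr _ IH u Jus; rewrite catA; apply: IH; apply: Jnext Jus sxr.
Qed.

(** Silent steps come only before the letter, so an infinite path is cut directly after each of its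
    visible labels. *)
Definition sblock s a t := exists r, weak s [::] r /\ trans r (Some a) t.

Lemma sblock_weak s a t : sblock s a t -> weak s [:: a] t.
Proof. by move=> [r [sr rt]]; exact: (weak_cat sr (weak_act rt)). Qed.

Lemma weak_consP s a u t : weak s (a :: u) t -> exists r, sblock s a r /\ weak r u t.
Proof.
pose P s v := forall a u, v = a :: u -> exists r, sblock s a r /\ weak r u t.
move=> h; suff H : P s (a :: u) by exact: H.
move: s (a :: u) h; apply: weak_ind_l => // s x r v sxr rt IH a' u'.
case: x sxr => [b|] sxr /= [].
  by move=> <- <-; exists r; split=> //; exists s; split=> //; exact: weak0.
move=> vE; have [r' [[q [rq qr']] r't]] := IH _ _ vE.
by exists r'; split=> //; exists q; split=> //; exact: (weak_cat (weak_tau sxr) rq).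
Qed.

Lemma weak_catP s u v t : weak s (u ++ v) t -> exists r, weak s u r /\ weak r v t.
Proof.
elim: u s => [|a u IH] s /=; first by exists s; split=> //; exact: weak0.
move=> /weak_consP[r [/sblock_weak sr /IH[q [rq qt]]]].
by exists q; split=> //; exact: (weak_cat sr rq).
Qed.

Lemma weak_word s u t : weak s u t -> word L u.
Proof.
move: s u; apply: weak_ind_l => [|s x r u sxr _ Lu]; first exact: List.Forall_nil.
by case: x sxr => [a|] // sar; apply: List.Forall_cons => //; exact: trans_alphabet sar.
Qed.

Lemma word_cat u v : word L (u ++ v) <-> word L u /\ word L v.
Proof. by rewrite /word List.Forall_app. Qed.

Lemma prefix_of_word xi : omega_word L xi <-> forall i, word L (prefix_of xi i).
Proof.
split=> [Lxi i|Lxi i].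
  elim: i => [|i IH]; first exact: List.Forall_nil.
  by rewrite prefix_ofS -cats1; apply/word_cat; split=> //; apply: List.Forall_cons.
have := Lxi i.+1; rewrite prefix_ofS -cats1 => /word_cat[_ h].
exact: List.Forall_inv h.
Qed.

Lemma diverges_coind (G : state L -> Prop) s :
  (forall s, G s -> exists t, trans s None t /\ G t) -> G s -> diverges s.
Proof. by move=> Gn Gs; have [p [p0 pP _]] := dependent_choice Gn Gs; exists p. Qed.

Lemma diverges_inv s : diverges s -> exists t, trans s None t /\ diverges t.
Proof.
move=> [p [p0 pP]]; rewrite -p0; exists (p 1).
by split; [exact: pP|exists (p \o succn)]; split=> // i; exact: pP.
Qed.

Definition tau_wf s := Acc (fun t s => trans s None t) s.

(** By dependent choice, a state outside the accessible part starts an infinite silent path.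
    Non-divergence of contexts is thereby proved by induction on silent steps. *)
Lemma tau_wfP s : tau_wf s <-> ~ diverges s.
Proof.
split; first by elim=> r _ IH /diverges_inv[t [/IH]].
move=> nds; apply: contrapT => ns; apply: nds.
apply: (diverges_coind (G := fun s => ~ tau_wf s)) ns => r nr.
apply: contrapT => h; apply: nr; apply: Acc_intro => t rt.
by apply: contrapT => nt; apply: h; exists t.
Qed.

Definition stable s := forall t, ~ trans s None t.

Lemma stable_not_diverges s : stable s -> ~ diverges s.
Proof. by move=> ss /diverges_inv[t [/ss]]. Qed.

Lemma not_diverges_stable s : ~ diverges s -> exists t, weak s [::] t /\ stable t.
Proof.
move=> /tau_wfP; elim=> r _ IH; have [[t rt]|nr] := EM (exists t, trans r None t).
  by have [q [tq sq]] := IH _ rt; exists q; split=> //; exact: (weak_cat (weak_tau rt) tq).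
by exists r; split; [exact: weak0|move=> t rt; apply: nr; exists t].
Qed.

Lemma weak_nil_chain s t : weak s [::] t -> exists w, run s (nseq w None) t.
Proof.
suff H : forall s u, weak s u t -> u = [::] -> exists w, run s (nseq w None) t.
  by move=> h; exact: H h erefl.
apply: weak_ind_l => [_|{}s [a|] // r u sr _ IH /= /IH[w rw]]; first by exists 0.
by exists w.+1; exists r.
Qed.

(** Each block contains at least one silent step; [H] counts down to the end of the current block,
    which reduces the claim to [diverges_coind]. *)
Lemma diverges_chain (G : state L -> Prop) s :
  (forall s, G s -> exists r t, [/\ weak s [::] r, trans r None t & G t]) ->
  G s -> diverges s.
Proof.
move=> Gn Gs; pose H s := exists w r t, [/\ run s (nseq w None) r, trans r None t & G t].
have GH t : G t -> H t.
  by move=> /Gn[r [q [/weak_nil_chain[w tr] rq Gq]]]; exists w, r, q.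
apply: (diverges_coind (G := H)); last exact: GH.
move=> {Gs}s [[|w] [r [t [/= sr rt Gt]]]]; first by subst r; exists t; split=> //; exact: GH.
by have [s1 [? ?]] := sr; exists s1; split=> //; exists w, r, t.
Qed.

(** * Infinite traces as chains of finite steps *)

Lemma weak_inf_blocks s xi : weak_inf s xi ->
  exists q : nat -> state L, q 0 = s /\ forall i, sblock (q i) (xi i) (q i.+1).
Proof.
move=> [p [lab [pos [p0 pP posM labpos labN]]]].
(* [start k] is the position just after the preceding visible label. Since [pos] is strictly
   increasing, only silent labels lie from there up to [pos k]. *)
pose start k := if k is k'.+1 then (pos k').+1 else 0.
exists (p \o start); split=> //= k.
exists (p (pos k)); split; last by rewrite -labpos; exact: pP.
have startk : start k <= pos k by case: k => //= k; exact: posM.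
have labk i : start k <= i -> i < pos k -> lab i = None.
  case labi: (lab i) => [a|] // ki ik; have [|j iE] := labN i; first by rewrite labi.
  move: ki ik; rewrite iE; have [kj|] := leqP k j.
    by move=> _; rewrite ltnNge; case/negP; case: ltngtP kj => // [/posM/ltnW|->].
  case: k startk => // k /= _; rewrite ltnS => jk.
  by rewrite ltnNge; case/negP; case: ltngtP jk => // [/posM/ltnW|->].
suff H n : start k + n <= pos k -> weak (p (start k)) [::] (p (start k + n)).
  by have := H (pos k - start k); rewrite subnKC //; exact.
elim: n => [|n IH]; first by rewrite addn0 => _; exact: weak0.
rewrite addnS => ltk; apply: (weak_cat (IH (ltnW ltk))); apply: weak_tau.
by rewrite -(labk (start k + n)) ?leq_addr //; exact: pP.
Qed.

(* A configuration [(m, s, n)] is in state [s], has shown [m] letters, and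
   shows the next letter after exactly [n] silent steps. *)
Lemma weak_inf_coind (G : nat -> state L -> Prop) s xi :
  (forall m s, G m s -> exists t, sblock s (xi m) t /\ G m.+1 t) ->
  G 0 s -> weak_inf s xi.
Proof.
move=> Gnext G0.
pose H (c : nat * state L * nat) := exists r t,
  [/\ run c.1.2 (nseq c.2 None) r, trans r (Some (xi c.1.1)) t & G c.1.1.+1 t].
pose R (c c' : nat * state L * nat) :=
  if c.2 is n.+1 then [/\ c'.1.1 = c.1.1, c'.2 = n & trans c.1.2 None c'.1.2]
  else c'.1.1 = c.1.1.+1 /\ trans c.1.2 (Some (xi c.1.1)) c'.1.2.
have GH m t : G m t -> exists n, H (m, t, n).
  by move=> /Gnext[t' [[r [/weak_nil_chain[n tr] rt']] Gt']]; exists n, r, t'.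
have [n0 H0] := GH _ _ G0.
have Hnext c : H c -> exists c', R c c' /\ H c'.
  case: c => -[m t] [|n] [r [t' /= [tr rt' Gt']]].
    have [n' Hn'] := GH _ _ Gt'.
    by exists (m.+1, t', n'); rewrite /R /= tr; split.
  by move: tr => [q [tq qr]]; exists (m, q, n); split=> //; exists r, t'.
have [c [c0 cR _]] := dependent_choice Hnext H0.
pose lab i := if (c i).2 is 0 then Some (xi (c i).1.1) else None.
have mS i : (c i.+1).1.1 = (c i).1.1 + ((c i).2 == 0).
  by have := cR i; rewrite /R; case: (c i).2 => [[-> _]|n [-> _ _]]; rewrite ?addn1 ?addn0.
have mM i j : i <= j -> (c i).1.1 <= (c j).1.1.
  move/subnKC <-; elim: (j - i) => [|d IH]; first by rewrite addn0.
  by rewrite addnS mS; apply: leq_trans IH (leq_addr _ _).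
have wait n i : (c i).2 = n -> exists j, (c j).2 = 0 /\ (c j).1.1 = (c i).1.1.
  elim: n i => [|n IH] i ci; first by exists i.
  have := cR i; rewrite /R ci => -[mi ni _].
  by have [j [? mj]] := IH _ ni; exists j; rewrite mj.
(* Letter [k] is shown where the countdown is 0 and [k] letters have been shown before. This place
   is unique, because the letter count never decreases and rises right after it. *)
have /choice[pos posP] : forall k, exists i, (c i).2 = 0 /\ (c i).1.1 = k.
  elim=> [|k [i [ci mi]]].
    by have [j [? mj]] := wait _ 0 erefl; exists j; rewrite mj c0.
  have [j [? mj]] := wait _ i.+1 erefl; exists j; split=> //.
  by rewrite mj mS ci mi addn1.
have posM j k : j < k -> pos j < pos k.
  rewrite ltnNge => jk; rewrite ltnNge; apply: contra jk => /mM.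
  by have [_ ->] := posP j; have [_ ->] := posP k.
exists (fun i => (c i).1.2), lab, pos; split=> //.
- by rewrite c0.
- by move=> i; have := cR i; rewrite /R /lab; case: (c i).2 => [|n] [].
- by move=> k; rewrite /lab; have [-> ->] := posP k.
move=> i; rewrite /lab; case ci: (c i).2 => // _; exists (c i).1.1.
have [ck mk] := posP (c i).1.1.
case: (ltngtP i (pos (c i).1.1)) => // /mM; rewrite mS.
  by rewrite ci mk addn1 ltnn.
by rewrite ck mk addn1 ltnn.
Qed.

(** The cut points [n i] may repeat, so segments may be empty. The coinductive invariant keeps a cut
    ahead of the current letter; since [n] is unbounded it can be moved further ahead, and the next
    letter is then split off from the word leading to it. *)
Lemma weak_inf_words (q : nat -> state L) (n : nat -> nat) xi :
  n 0 = 0 -> (forall i, n i <= n i.+1) -> (forall m, exists i, m <= n i) ->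
  (forall i, weak (q i) (prefix_of (fun j => xi (n i + j)) (n i.+1 - n i)) (q i.+1)) ->
  weak_inf (q 0) xi.
Proof.
move=> n0 nS nU qP.
pose seg m k := prefix_of (fun j => xi (m + j)) (k - m).
have segD m k l : m <= k -> k <= l -> seg m l = seg m k ++ seg k l.
  move=> mk kl; rewrite /seg -{1}(subnKC kl) -addnBAC // prefix_ofD; congr (_ ++ _).
  by congr prefix_of; apply: funext => j; rewrite addnA subnKC.
have nM i d : n i <= n (i + d).
  by elim: d => [|d IH]; rewrite ?addn0 // addnS (leq_trans IH).
have far i d m : m <= n i -> forall s, weak s (seg m (n i)) (q i) ->
    weak s (seg m (n (i + d))) (q (i + d)).
  move=> mi s si; elim: d => [|d IH]; first by rewrite addn0.
  rewrite addnS (@segD _ (n (i + d))) //; last exact: leq_trans mi (nM _ _).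
  exact: weak_cat IH (qP _).
apply: (@weak_inf_coind (fun m s => exists i, m <= n i /\ weak s (seg m (n i)) (q i))).
  move=> m s [i [mi si]]; have [j mj] := nU m.+1.
  have mij : m < n (i + j) by rewrite addnC; apply: leq_trans mj (nM _ _).
  have := far i j m mi s si; rewrite (@segD _ m.+1) // {1}/seg subSnn.
  rewrite /prefix_of /= addn0 => /weak_consP[t [? ?]].
  by exists t; split=> //; exists (i + j).
by exists 0; rewrite n0 /seg subn0; split=> //; exact: weak0.
Qed.

Lemma weak_inf_weak (q : nat -> state L) xi :
  (forall i, weak (q i) [:: xi i] (q i.+1)) -> weak_inf (q 0) xi.
Proof.
move=> qP; apply: (@weak_inf_words q id) => // [m|i]; first by exists m.
by rewrite prefix_of_step.
Qed.

Lemma blocks_weak (q : nat -> state L) xi i :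
  (forall i, sblock (q i) (xi i) (q i.+1)) -> weak (q 0) (prefix_of xi i) (q i).
Proof.
move=> qP; elim: i => [|i IH]; first exact: weak0.
by rewrite prefix_ofS -cats1; exact: weak_cat IH (sblock_weak (qP i)).
Qed.

End Runs.

(** * Elementary relations between the semantic sets *)

Section Sets.
Variables (Act : Type) (L : LTS Act).
Implicit Types (u v : seq Act) (xi : nat -> Act).

Lemma TrP u : Tr L u <-> exists s, weak (init L) u s.
Proof. by split=> [[_ ?]//|[s h]]; split; [exact: weak_word h|exists s]. Qed.

Lemma DivP u : Div L u <-> exists s, weak (init L) u s /\ diverges s.
Proof. by split=> [[_ ?]//|[s [h ds]]]; split; [exact: weak_word h|exists s]. Qed.

Lemma SfP u (A : set Act) : Sf L (u, A) <->
  A `<=` alphabet L /\ exists s, [/\ weak (init L) u s, stable s &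
    forall a, A a -> forall t, ~ trans s (Some a) t].
Proof.
split=> [[_ ? ?]|[AL [s [h ss sA]]]]; split=> //; last by exists s.
exact: weak_word h.
Qed.

Lemma InfP xi : Inf L xi <-> weak_inf (init L) xi.
Proof.
split=> [[]//|h]; split=> //; apply/prefix_of_word => i.
by have [q [q0 qP]] := weak_inf_blocks h; exact: weak_word (blocks_weak i qP).
Qed.

Lemma Inf_words (q : nat -> state L) (n : nat -> nat) xi :
  weak (init L) (prefix_of xi (n 0)) (q 0) ->
  (forall i, n i <= n i.+1) -> (forall m, exists i, m <= n i) ->
  (forall i, weak (q i) (prefix_of (fun j => xi (n i + j)) (n i.+1 - n i)) (q i.+1)) ->
  Inf L xi.
Proof.
move=> q0 nS nU qP; apply/InfP.
(* The initial segment is put in front as an additional step, from [init L] with cut point 0. *)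
apply: (@weak_inf_words _ _ (fun i => if i is i'.+1 then q i' else init L)
  (fun i => if i is i'.+1 then n i' else 0)) => //.
- by case.
- by move=> m; have [i mi] := nU m; exists i.+1.
by case=> // ; rewrite subn0.
Qed.

Lemma Inf_cat xi i s : weak (init L) (prefix_of xi i) s ->
  weak_inf s (fun j => xi (i + j)) -> Inf L xi.
Proof.
move=> si /weak_inf_blocks[q [q0 qP]].
apply: (Inf_words (q := q) (n := addn i)); rewrite ?addn0 ?q0 // => m; first by rewrite addnS.
  by exists m; rewrite leq_addl.
by rewrite addnS prefix_of_step; exact: sblock_weak.
Qed.

Lemma Inf_Tr xi i : Inf L xi -> Tr L (prefix_of xi i).
Proof.
move=> /InfP/weak_inf_blocks[q [q0 qP]]; apply/TrP.
by rewrite -q0; exists (q i); exact: blocks_weak.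
Qed.

Lemma Div_Tr u : Div L u -> Tr L u.
Proof. by move=> /DivP[s [h _]]; apply/TrP; exists s. Qed.

Lemma Sf_Tr f : Sf L f -> Tr L f.1.
Proof. by case: f => u A /SfP[_ [s [h _ _]]]; apply/TrP; exists s. Qed.

Lemma Tr_word u : Tr L u -> word L u. Proof. by case. Qed.

Lemma Tr_catl u v : Tr L (u ++ v) -> Tr L u.
Proof. by move=> /TrP[s /weak_catP[r [h _]]]; apply/TrP; exists r. Qed.

(** A non-divergent trace leads to a state whose silent steps terminate, hence to a stable state,
    which refuses the empty set. Thus [Div] and [nF] determine [Tr]. *)
Lemma Tr_nF u : Tr L u <-> Div L u \/ nF L (u, set0).
Proof.
split=> [Tu|[/Div_Tr//|[/Sf_Tr]]] //; have [Du|nDu] := EM (Div L u); [by left|right].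
split=> //; apply/SfP; split=> //; have /TrP[s us] := Tu.
have [ds|/not_diverges_stable[t [st tS]]] := EM (diverges s).
  by case: nDu; apply/DivP; exists s.
by exists t; split=> //; rewrite -[u]cats0; exact: weak_cat us st.
Qed.

(** The shortest divergent prefix of [u] belongs to [minD]. *)
Lemma Div_extT u v : Div L u -> word L (u ++ v) -> extT L (u ++ v).
Proof.
move=> Du Luv; split=> //.
have exD : exists i, `[< Div L (take i u) >] by exists (size u); rewrite take_size; apply/asboolP.
have [i /asboolP Di imin] := ex_minnP exD.
have iu : i <= size u by apply: imin; rewrite take_size; apply/asboolP.
exists i; rewrite size_cat (leq_trans iu (leq_addr _ _)) takel_cat //; split=> //; split=> //.
move=> j; rewrite size_takel; last exact: iu.
move=> ji; rewrite take_takel; last exact: ltnW ji.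
by move=> /asboolP/imin; rewrite leqNgt ji.
Qed.

Lemma extT_Div u : Div L u -> extT L u.
Proof. by move=> Du; rewrite -[u]cats0; apply: Div_extT; rewrite ?cats0 //; case: Du. Qed.

Lemma extT_cat u v : extT L u -> word L (u ++ v) -> extT L (u ++ v).
Proof.
move=> [_ [i [iu mi]]] Luv; split=> //; exists i; rewrite takel_cat //; split=> //.
by rewrite size_cat (leq_trans iu (leq_addr _ _)).
Qed.

Lemma extI_Div xi i : omega_word L xi -> Div L (prefix_of xi i) -> extI L xi.
Proof.
move=> Lxi /extT_Div[_ [j [ji mj]]]; split=> //; exists j.
by move: ji mj; rewrite size_prefix_of => /take_prefix_of ->.
Qed.

End Sets.

(** * Testing contexts *)

(* A maximal family of injective sequences with disjoint ranges misses only
   finitely many points, which can be put in front of one of the sequences;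
   then [f0] and [f1] double the index along each sequence. *)
Lemma disjoint_injections (T : Type) : infinite_set [set: T] ->
  exists f0 f1 : T -> T, [/\ injective f0, injective f1 & forall x y, f0 x <> f1 y].
Proof.
elim/Ppointed: T => T Tinf; first by case: Tinf; rewrite emptyE.
pose P (F : set (nat -> T)) := (forall f, F f -> injective f) /\
  forall f g i j, F f -> F g -> f i = g j -> f = g.
have [F [[Finj Fdis] Fmax]] : exists F, P F /\ forall G, F `<` G -> ~ P G.
  apply: Zorn_bigcup => C CP Ctot; split=> [f [X CX Xf]|f g i j [X CX Xf] [Y CY Yg]].
    by have [h _] := CP _ CX; exact: h.
  by have [XY|YX] := Ctot _ _ CX CY;
    [have [_ h] := CP _ CY|have [_ h] := CP _ CX]; apply: h; auto.
pose R := [set x | forall f i, F f -> f i <> x].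
have Rfin : finite_set R.
  apply: contrapT => /infiniteP/pcard_leP[g].
  have gR i : R (g i) by have := @funS _ _ _ _ g; exact.
  have ginj : injective g by move=> i j; apply: inj; rewrite inE.
  have gF : ~ F g by move=> Fg; have := gR 0 g 0 Fg.
  apply: (Fmax (F `|` [set (g : nat -> T)])).
    split=> [f Ff|h]; first by left.
    by apply: gF; apply: h; right.
  split=> [f [Ff|->]//|f h i j]; first exact: Finj.
  by move=> [Ff|->] [Fh|->] //; [exact: Fdis|move=> e; case: (gR j f i)
    |move=> /esym e; case: (gR i h j)].
have [f Ff] : exists f, F f.
  apply: contrapT => nF; apply: Tinf; apply: sub_finite_set Rfin => x _ f i Ff.
  by case: nF; exists f.
have /finite_setP[n] := Rfin.
rewrite card_eq_sym => /card_set_bijP[r [rR rinj rsurj]].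
pose f' i := if i < n then r i else f (i - n).
have f'inj : injective f'.
  move=> i j; rewrite /f'; case: ltnP => ni; case: ltnP => nj.
  - by apply: rinj; rewrite inE.
  - by move=> e; case: (rR i ni f (j - n)).
  - by move=> e; case: (rR j nj f (i - n)).
  - by move/(Finj f Ff) => e; rewrite -(subnK ni) -(subnK nj) e.
pose F' g := g = f' \/ F g /\ g <> f.
have F'inj g : F' g -> injective g by move=> [->|[/Finj]].
have F'dis g h i j : F' g -> F' h -> g i = h j -> g = h.
  have aux k h' j' : F h' -> h' <> f -> f' k <> h' j'.
    move=> Fh hf; rewrite /f'; case: ltnP => kn e.
      by case: (rR k kn h' j').
    by apply: hf; apply: (Fdis _ _ j' (k - n)).
  move=> [->|[Fg gf]] [->|[Fh hf]] //; last exact: Fdis.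
    by move/aux; case.
  by move/esym/aux; case.
have /choice[e eP] : forall x, exists gk : (nat -> T) * nat, F' gk.1 /\ gk.1 gk.2 = x.
  move=> x; have [/rsurj[i ni <-]|nRx] := EM (R x).
    by exists (f', i); split; [left|rewrite /= /f' ni].
  have [g [i [Fg gi]]] : exists g i, F g /\ g i = x.
    apply: contrapT => h; apply: nRx => g i Fg gi; apply: h; by exists g, i.
  have [gf|gf] := EM (g = f); last by exists (g, i); split=> //; right.
  exists (f', n + i); split; first by left.
  by rewrite /= /f' ltnNge leq_addr /= addKn -gf.
have einj x y i j : (e x).1 i = (e y).1 j -> (e x).1 = (e y).1 /\ i = j.
  have [Fx _] := eP x; have [Fy _] := eP y => exy.
  have E := F'dis _ _ _ _ Fx Fy exy; split=> //.
  by apply: (F'inj _ Fx); rewrite exy E.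
have eE x y : (e x).1 = (e y).1 -> (e x).2 = (e y).2 -> x = y.
  by have [_ {3}<-] := eP x; have [_ {3}<-] := eP y => -> ->.
exists (fun x => (e x).1 (e x).2.*2), (fun x => (e x).1 (e x).2.*2.+1); split.
- by move=> x y /einj[exy /double_inj]; exact: eE.
- by move=> x y /einj[exy [/double_inj]]; exact: eE.
- by move=> x y /einj[_ /(congr1 odd)]; rewrite /= !odd_double.
Qed.

(** * Parallel composition with a tester, all moves of the tested system being hidden *)

Section Composition.
Variable Act : Type.
Implicit Types (K : LTS Act) (S : set Act).

(* A tester move is labelled [inl a] when it is visible and [inr x] when it is
   a joint move with [K] on [x]; in [tested K] all moves of [K] are hidden. *)
Definition tester (T : Type) := T -> option (Act + Act) -> T -> Prop.

Definition comp_trans K T (tt : tester T) S (c : state K * T) (y : option Act)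
    (c' : state K * T) : Prop :=
  if y is Some a then [/\ S a, c'.1 = c.1 & tt c.2 (Some (inl a)) c'.2]
  else [\/ c'.1 = c.1 /\ tt c.2 None c'.2, trans c.1 None c'.1 /\ c'.2 = c.2
    | exists x, trans c.1 (Some x) c'.1 /\ tt c.2 (Some (inr x)) c'.2].

Lemma comp_trans_alphabet K T (tt : tester T) S c a c' :
  comp_trans (K := K) tt S c (Some a) c' -> S a.
Proof. by case. Qed.

Definition tested K T (tt : tester T) (t0 : T) S : LTS Act :=
  @MkLTS Act (state K * T)%type S (comp_trans tt S) (init K, t0)
    (@comp_trans_alphabet K T tt S).

(** Equality of the records, by proof irrelevance, makes it possible to rewrite [tested] into a term
    built from the operators, with no transfer of semantic sets. *)
Lemma LTS_ext (X : Type) (A A' : set Act) (tr tr' : X -> option Act -> X -> Prop)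
    (x0 : X) p p' :
  A = A' -> (forall s y s', tr s y s' <-> tr' s y s') ->
  @MkLTS Act X A tr x0 p = @MkLTS Act X A' tr' x0 p'.
Proof.
move=> AA' trE; have trE' : tr = tr'.
  by apply: funext => s; apply: funext => y; apply: funext => s'; apply/propeqP.
by case: _ / AA' p'; case: _ / trE' => p'; rewrite (Prop_irrelevance p p').
Qed.

Section AsOperators.
Variables (f0 f1 : Act -> Act).
Hypotheses (f0inj : injective f0) (f1inj : injective f1)
  (f01 : forall x y, f0 x <> f1 y).
Variables (T : Type) (tt : tester T) (t0 : T) (S SK : set Act).

Definition tester_trans (t : T) (y : option Act) (t' : T) : Prop :=
  if y is Some b then
    (exists a, [/\ S a, b = f0 a & tt t (Some (inl a)) t']) \/
    (exists x, [/\ SK x, b = f1 x & tt t (Some (inr x)) t'])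
  else tt t None t'.

Lemma tester_trans_alphabet t b t' :
  tester_trans t (Some b) t' -> (f0 @` S `|` f1 @` SK) b.
Proof. by move=> [[a [Sa -> _]]|[x [Sx -> _]]]; [left; exists a|right; exists x]. Qed.

Definition tester_lts : LTS Act :=
  @MkLTS Act T (f0 @` S `|` f1 @` SK) tester_trans t0 tester_trans_alphabet.

Definition op_comp K : LTS Act :=
  rename (hiding (par (rename K [set p | p.2 = f1 p.1]) tester_lts) (f1 @` SK))
    [set p | p.1 = f0 p.2].

Lemma op_compE K : alphabet K = SK -> op_comp K = tested K tt t0 S.
Proof.
move=> KSK.
have renE a b : renames [set p | p.2 = f1 p.1] a b <-> b = f1 a.
  by split=> [[//|[_ []]]|->]; [exists (f1 a)|left].
have alphaE b : alphabet (rename K [set p | p.2 = f1 p.1]) b <-> (f1 @` SK) b.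
  rewrite -KSK; split=> [[a [Ka /renE ->]]|[a Ka <-]]; first by exists a.
  by exists a; split=> //; exact/renE.
have sharedE b : shared (rename K [set p | p.2 = f1 p.1]) tester_lts (Some b) <-> (f1 @` SK) b.
  by split=> [[/alphaE]//|h]; split; [exact/alphaE|right].
(* A renaming keeps labels outside its domain, so [b] must be known to lie in the range of [f0];
   this holds for the labels that survive the hiding. *)
have backE b a : renames [set p | p.1 = f0 p.2] b a -> (exists a', b = f0 a') -> b = f0 a.
  by move=> [//|[_ h]] [a' ba']; case: h; exists a'.
apply: LTS_ext.
  apply/predeqP => a; split.
    move=> [b [[[/alphaE//|[[a' Sa' ba']|//]] _] ba]].
    have := backE _ _ ba (ex_intro _ a' (esym ba')).
    by rewrite -ba' => /f0inj <-.
  move=> Sa; exists (f0 a); split; last by left.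
  by split; [right; left; exists a|move=> [x _] /esym/f01].
move=> [k t] y [k' t']; split.
  case: y => [a|] /=.
    move=> [b [[x [kx xb]] ba]]; case: x kx xb => [b'|] kx //= [[_ //]|[nb [bb']]].
    subst b'; case: kx => [[/sharedE//]|[_ /= [x [kx /renE bx]] _]|[_ /= kk' [|]]].
    - by case: nb; exists x; rewrite // -KSK; exact: trans_alphabet kx.
    - move=> [a' [Sa' ba' ta]].
      have := backE _ _ ba (ex_intro _ a' ba'); rewrite ba' => /f0inj aa'.
      by rewrite -aa'.
    - by move=> [x [Sx bx _]]; case: nb; exists x.
  move=> [[b|] /= [kx]].
    move=> [[fb _]|[_ //]]; case: kx => [[_ /= [x [kx /renE bx]]]|[/sharedE//]|[/sharedE//]].
    move=> [[a [_ ba]]|[x' [_ bx' tx]]].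
      by case: (@f01 a x); rewrite -ba.
    apply: Or33; exists x; split=> //.
    by have /f1inj -> : f1 x = f1 x' by rewrite -bx.
  move=> _; case: kx => [[//]|[_ /= kk' tt']|[_ /= kk' tt']].
    by apply: Or32.
  by apply: Or31.
case: y => [a|] /=.
  move=> [Sa kk' ta]; exists (f0 a); split; last by left.
  have nf : ~ (f1 @` SK) (f0 a) by move=> [x _] /esym/f01.
  exists (Some (f0 a)); split; last by right.
  apply: Or33; split=> //; first by move/sharedE.
  by left; exists a.
move=> [[kk' ta]|[kk' ta]|[x [kx tx]]].
- by exists None; split=> //; apply: Or33; split.
- by exists None; split=> //; apply: Or32; split.
have SKx : SK x by rewrite -KSK; exact: trans_alphabet kx.
exists (Some (f1 x)); split; last by left; split=> //; exists x.
apply: Or31; split=> /=; first by apply/sharedE; exists x.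
  by exists x; split=> //; exact/renE.
by right; exists x.
Qed.

End AsOperators.

(** Only the alphabet of [K] enters the tester, so equal alphabets give the same operator context
    around [K] and [K']. Infinitely many actions provide the disjoint copies [f0] and [f1]. *)
Lemma comp_cong (cong : LTS Act -> LTS Act -> Prop) K K' T (tt : tester T) t0 S :
  infinite_set [set: Act] -> congruence cong -> alphabet K = alphabet K' ->
  cong K K' -> cong (tested K tt t0 S) (tested K' tt t0 S).
Proof.
move=> /disjoint_injections[f0 [f1 [f0inj f1inj f01]]] Hc KK' cKK'.
rewrite -(op_compE f0inj f1inj f01 tt t0 S (erefl : alphabet K = _)).
rewrite -(op_compE f0inj f1inj f01 tt t0 S (esym KK')).
apply: (congruence_rename Hc); apply: (congruence_hide Hc).
by apply: (congruence_parl Hc); exact: (congruence_rename Hc).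
Qed.

Section CompRuns.
Variables (K : LTS Act) (T : Type) (tt : tester T) (t0 : T) (S : set Act).
Local Notation C := (tested K tt t0 S).
Implicit Types (k : state K) (t : T) (u v : seq Act).

Lemma comp_trans_tau k t t' : tt t None t' -> @trans _ C (k, t) None (k, t').
Proof. by move=> h; apply: Or31. Qed.

Lemma comp_trans_hidden k k' t : trans k None k' -> @trans _ C (k, t) None (k', t).
Proof. by move=> h; apply: Or32. Qed.

Lemma comp_trans_sync k k' x t t' :
  trans k (Some x) k' -> tt t (Some (inr x)) t' -> @trans _ C (k, t) None (k', t').
Proof. by move=> kx tx; apply: Or33; exists x. Qed.

(** [W] names the tester state belonging to each prefix of the word that [K] performs. *)
Lemma comp_walk (W : seq Act -> T) k u v k' :
  weak k v k' ->
  (forall w x w', v = w ++ x :: w' -> tt (W (u ++ w)) (Some (inr x)) (W (u ++ rcons w x))) ->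
  @weak _ C (k, W u) [::] (k', W (u ++ v)).
Proof.
pose P k v := forall u,
  (forall w x w', v = w ++ x :: w' -> tt (W (u ++ w)) (Some (inr x)) (W (u ++ rcons w x))) ->
  @weak _ C (k, W u) [::] (k', W (u ++ v)).
move=> h; suff H : P k v by exact: H.
move: k v h {u}; apply: weak_ind_l => [u _|k x r v kr _ IH u Wv].
  by rewrite cats0; exact: weak0.
case: x kr Wv => [x|] kr Wv /=; last first.
  apply: (@weak_tau_l _ C _ (r, W u)); [exact: comp_trans_hidden|exact: IH].
have := Wv [::] x v erefl; rewrite /= cats0 => Wx.
apply: (@weak_tau_l _ C _ (r, W (u ++ [:: x]))); first exact: comp_trans_sync kr Wx.
rewrite -[x :: v]cat1s catA.
by apply: (IH (u ++ [:: x])) => w y w' vE; rewrite -!catA; apply: (Wv (x :: w) y w'); rewrite vE.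
Qed.

Lemma comp_hidden k k' t : weak k [::] k' -> @weak _ C (k, t) [::] (k', t).
Proof. by move=> kk'; apply: (comp_walk (W := fun _ => t) (u := [::]) kk'); case. Qed.

Lemma comp_free_walk (W : seq Act -> T) k u v k' :
  (forall w x, tt (W w) (Some (inr x)) (W (rcons w x))) ->
  weak k v k' -> @weak _ C (k, W u) [::] (k', W (u ++ v)).
Proof. by move=> Wx kk'; apply: comp_walk kk' _ => w x _ _; rewrite -rcons_cat. Qed.

End CompRuns.

Section Prefix.
Variables (K : LTS Act) (d : Act).
Local Notation X := (act_prefix d K).
Implicit Types (k : state K).

Lemma prefix_trans0 y (x : state X) :
  trans (None : state X) y x -> y = Some d /\ x = Some (init K).
Proof. by case: x => //= k [-> ->]. Qed.

Lemma prefix_weak k v k' : weak k v k' -> @weak _ X (Some k) v (Some k').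
Proof.
move: k v; apply: weak_ind_l => [|k y r v kr _ IH]; first exact: weak0.
by apply: (@weak_cons _ X _ _ (Some r)).
Qed.

End Prefix.
End Composition.

(** * Following a system and branching off at its divergences *)

Section Extension.
Variables (Act : Type) (L : LTS Act) (d : Act).
Variables (Q : Type) (exit : seq Act -> seq Act -> Q -> Prop) (qt : tester Act Q).
Implicit Types (r u v : seq Act) (q : Q).

(* Follow [L], remembering the trace [r]; in a diverging state one may start
   [K], make it perform an arbitrary trace [u], and leave to a second phase. *)
Inductive ext :=
  | Follow (s : state L) r
  | Walk r u
  | Exit q.

Definition ext_tester : tester Act ext := fun t y t' =>
  match t, t' with
  | Follow s r, Follow s' r' =>
      exists x, [/\ y = omap inl x, trans s x s' & r' = r ++ lbl x]
  | Follow s r, Walk r' u => [/\ y = Some (inr d), diverges s, r' = r & u = [::]]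
  | Walk r u, Walk r' u' => r' = r /\ exists x, y = Some (inr x) /\ u' = rcons u x
  | Walk r u, Exit q => y = None /\ exit r u q
  | Exit q, Exit q' => qt q y q'
  | _, _ => False
  end.

(** The prefix [d] keeps [K] from every move, silent ones included, until the tester starts it. *)
Definition extension (K : LTS Act) : LTS Act :=
  tested (act_prefix d K) ext_tester (Follow (init L) [::]) (alphabet L).

Lemma extension_cong (cong : LTS Act -> LTS Act -> Prop) K K' :
  infinite_set [set: Act] -> congruence cong -> alphabet K = alphabet K' ->
  cong K K' -> cong (extension K) (extension K').
Proof.
move=> Ainf Hc KK' cKK'; apply: comp_cong => //=; first by rewrite KK'.
exact: (congruence_prefix Hc).
Qed.

(** A second-phase state [q] determines the visible trace [qo q] shown so far and the trace [qg q]
    that [K] has performed; [qinv] is an invariant of the second phase. *)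
Variables (qo qg : Q -> seq Act) (qinv : Q -> Prop).
Hypothesis exitP : forall r u q, Div L r -> exit r u q ->
  [/\ qinv q, qo q = r & qg q = u].
Hypothesis qtP : forall q y q', qinv q -> qt q y q' ->
  [/\ qinv q', qo q' = qo q ++ (if y is Some (inl a) then [:: a] else [::])
    & qg q' = qg q ++ (if y is Some (inr x) then [:: x] else [::])].

Variable K : LTS Act.
Local Notation C := (extension K).
Implicit Types (k : state K).

Definition reached r (k : state K) q :=
  [/\ qo q = r, qinv q & weak (init K) (qg q) k].

(** [None] is the initial state of the prefixed [K]: while [L] is followed, [K] is untouched. *)
Definition ext_inv r (c : state C) : Prop :=
  match c.2 with
  | Follow s r' => [/\ c.1 = None, r' = r & weak (init L) r s]
  | Walk r' u => [/\ r' = r, Div L r & exists k, c.1 = Some k /\ weak (init K) u k]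
  | Exit q => exists k, c.1 = Some k /\ reached r k q
  end.

Lemma ext_inv_trans r (c c' : state C) y :
  ext_inv r c -> trans c y c' -> ext_inv (r ++ lbl y) c'.
Proof.
case: c => x [s r'|r' u|q]; rewrite /ext_inv /=.
- move=> [-> -> rs]; case: y => [a|] /=.
    case: c' => x' [s' r''|r'' u'|q'] [_ /= ->]; [|by case|by []].
    by move=> [[b|] [] //= [<-] ss' ->]; split=> //; exact: (weak_rcons rs ss').
  case: c' => x' t' /= [[-> ]|[]|[b []]]; last 2 first.
  - by case: x' => // k' [[]].
  - case: x' => // k' [_ ->]; case: t' => [s' r''|r'' u|//]; first by move=> [[?|] []].
    move=> [_ ds -> ->]; rewrite cats0; split=> //; first by apply/DivP; exists s.
    by exists (init K); split=> //; exact: weak0.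
  case: t' => [s' r''|r'' u|//]; last by case.
  by move=> [[?|] [] // _ ss' ->]; rewrite /= cats0; split=> //; exact: weak_tau_r rs ss'.
- move=> [-> Dr [k [-> ku]]]; case: y => [a|] /=.
    by case: c' => x' [s' r''|r'' u'|q'] [_ /= _ //]; [move=> [_ [? []]]|case].
  rewrite cats0; case: c' => x' t' /= [[-> ]|[]|[b []]].
  - case: t' => [//|r'' u' [_ [? []]]//|q [_ /(exitP Dr)[qi qr qu]]].
    by exists k; split=> //; split=> //; rewrite qu.
  - by case: x' => // k' kk' ->; split=> //; exists k'; split=> //; exact: weak_tau_r ku kk'.
  case: x' => // k' kk'; case: t' => [//|r'' u' [-> [? [[<-] ->]]]|q []//].
  by split=> //; exists k'; split=> //; rewrite -cats1; exact: (weak_rcons ku kk').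
move=> [k [-> [qr qi ku]]]; case: y => [a|] /=.
  case: c' => x' [s' r''|r'' u'|q'] [_ /= ->] //= /(qtP qi)[qi' qr' qu'].
  by exists k; split=> //; split=> //; rewrite ?qr' ?qr // qu' cats0.
rewrite cats0; case: c' => x' t' /= [[-> ]|[]|[b []]].
- case: t' => [//|//|q' /(qtP qi)[qi' qr' qu']].
  by exists k; split=> //; split=> //; rewrite ?qr' ?qu' ?cats0.
- case: x' => // k' kk' ->; exists k'; split=> //; split=> //.
  exact: weak_tau_r ku kk'.
case: x' => // k' kk'; case: t' => [//|//|q' /(qtP qi)[qi' qr' qu']].
exists k'; split=> //; split=> //; first by rewrite qr' cats0.
by rewrite qu'; exact: (weak_rcons ku kk').
Qed.

Lemma ext_reach r c : weak (init C) r c -> ext_inv r c.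
Proof.
apply: (@weak_invariant _ C ext_inv _ [::]).
  by move=> u s x t; exact: ext_inv_trans.
by split=> //; exact: weak0.
Qed.
Lemma ext_follow s r u s' : weak s u s' ->
  @weak _ C (None, Follow s r) u (None, Follow s' (r ++ u)).
Proof.
move=> h; pose P s u := forall r, @weak _ C (None, Follow s r) u (None, Follow s' (r ++ u)).
suff H : P s u by exact: H.
move: s u h {r}; apply: weak_ind_l => [r|s y t u st _ IH r].
  by rewrite cats0; exact: weak0.
apply: (@weak_cons _ C _ y (None, Follow t (r ++ lbl y))); last by rewrite catA; exact: IH.
case: y st => [a|] st; first by split=> //; [exact: trans_alphabet st|exists (Some a)].
by apply: comp_trans_tau; exists None.
Qed.

Lemma ext_walk r u k : Div L r -> weak (init K) u k ->
  weak (init C) r (Some k, Walk r u).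
Proof.
move=> /DivP[s [rs ds]] uk; rewrite -(cats0 r).
apply: weak_cat (ext_follow [::] rs) _; rewrite cats0 /=.
apply: (@weak_tau_l _ C _ (Some (init K), Walk r [::])).
  by apply: (@comp_trans_sync _ (act_prefix d K) _ _ _ _ _ _ d).
have wk := @comp_free_walk _ (act_prefix d K) _ ext_tester (Follow (init L) [::])
  (alphabet L) (Walk r) (Some (init K)) [::] u (Some k).
apply: wk; last exact: prefix_weak.
by move=> w x; split=> //; exists x.
Qed.

Lemma ext_exit r u k q : Div L r -> weak (init K) u k -> exit r u q ->
  weak (init C) r (Some k, Exit q).
Proof.
move=> Dr uk ruq; apply: weak_tau_r (ext_walk Dr uk) _.
exact: comp_trans_tau.
Qed.

Lemma ext_Div_base r : Div L r -> Div C r.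
Proof.
move=> /DivP[s [rs ds]]; apply/DivP; exists (None, Follow s r); split.
  exact: (ext_follow [::] rs).
apply: (@diverges_coind _ C (fun c => exists s, diverges s /\ c = (None, Follow s r))); last by exists s.
move=> _ [s' [/diverges_inv[t [s't dt]] ->]]; exists (None, Follow t r); split; last by exists t.
by apply: comp_trans_tau; exists None; rewrite /= cats0.
Qed.

(** A stable state of [L] does not diverge, so [K] cannot be started there and the pair remains
    stable. *)
Lemma ext_Sf_base f : Sf L f -> Sf C f.
Proof.
case: f => r A /SfP[AL [s [rs ss sA]]]; apply/SfP; split=> //.
exists (None, Follow s r); split; first exact: (ext_follow [::] rs).
  move=> [x t] /= [[_]|[+ _]|[b [_]]]; last 2 first.
  - by case: x => // ? [].
  - case: t => [s' r'|r' u|q] //=; first by move=> [[?|] []].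
    by move=> [_ ds]; have := stable_not_diverges ss ds.
  - case: t => [s' r'|r' u|q] //=; last by case.
    by move=> [[?|] [//] _ /ss].
move=> a Aa [x t] /= [_ _]; case: t => [s' r'|r' u|q] //=; last by case.
by move=> [[b|] [//] [<-] /(sA _ Aa)].
Qed.

Lemma ext_Inf_base xi : Inf L xi -> Inf C xi.
Proof.
move=> /InfP/weak_inf_blocks[q [q0 qP]]; apply/InfP.
apply: (@weak_inf_coind _ C (fun m c => c = (None, Follow (q m) (prefix_of xi m)))).
  move=> m c ->; exists (None, Follow (q m.+1) (prefix_of xi m.+1)); split=> //.
  have [r [qr rq]] := qP m; exists (None, Follow r (prefix_of xi m)); split.
    by have := ext_follow (prefix_of xi m) qr; rewrite cats0.
  split=> //; first exact: trans_alphabet rq.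
  by exists (Some (xi m)); split=> //; rewrite prefix_ofS -cats1.
by rewrite q0.
Qed.

(** New divergences arise only in the second phase. A walk takes place at a divergent trace of [L],
    and before it the silent moves copy those of [L] until [K] is started, which again requires [L]
    to diverge. *)
Lemma ext_Div r : Div C r ->
  Div L r \/ exists k q, reached r k q /\ @diverges _ C (Some k, Exit q).
Proof.
move=> /DivP[[x t] [/ext_reach]]; rewrite /ext_inv /=.
case: t => [s r'|r' u|q]; last 1 first.
- by move=> [k [-> rk]] dk; right; exists k, q.
- move=> [-> -> rs] dc; left; apply/DivP; exists s; split=> //.
  apply: contrapT => /tau_wfP nds; move: dc; apply/tau_wfP.
  elim: nds {rs} => {}s nds IH; apply: Acc_intro => -[y t] /= [[->]|[+ _]|[b [/= _]]].
  + case: t => [s' r''|r'' u|q] /=; [|by case|by []].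
    move=> [[?|] [yE ss' ->]]; first by discriminate yE.
    rewrite cats0; exact: IH.
  + by case: y => [?|] [].
  + case: t => [s' r''|r'' u|q] /=; [by move=> [[?|] []]| |by []].
    by move=> [_ ds _ _]; have /tau_wfP := Acc_intro s nds.
by move=> [_ Dr _] _; left.
Qed.

(** The middle case, a walk in which [K] is stuck, occurs only at a divergent trace of [L], where
    [nF] disregards it. *)
Lemma ext_Sf r A : Sf C (r, A) -> A `<=` alphabet L /\
  [\/ Sf L (r, A),
     Div L r /\ exists u k, @stable _ C (Some k, Walk r u) /\ weak (init K) u k
   | exists k q, [/\ reached r k q, @stable _ C (Some k, Exit q) &
       forall a, A a -> forall c, ~ @trans _ C (Some k, Exit q) (Some a) c]].
Proof.
move=> /SfP[AL [[x t] [/ext_reach xt sc cA]]]; split; first exact: AL.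
move: xt; rewrite /ext_inv /=.
case: t sc cA => [s r'|r' u|q] sc cA.
- move=> [xE r'r rs]; apply: Or31; apply/SfP; split=> //; exists s; split=> // [s' ss'|a Aa s' ss'].
    apply: (sc (x, Follow s' (r' ++ [::]))); apply: comp_trans_tau.
    by exists None.
  apply: (cA a Aa (x, Follow s' (r' ++ [:: a]))); split=> //; first exact: AL.
  by exists (Some a).
- by move=> [r'r Dr [k [xk uk]]]; apply: Or32; split=> //; exists u, k; rewrite -xk -r'r.
by move=> [k [xk kr]]; apply: Or33; exists k, q; rewrite -xk.
Qed.

Lemma exit_weak r k q v c : reached r k q -> @weak _ C (Some k, Exit q) v c ->
  exists k' q' w, [/\ c = (Some k', Exit q'), reached (r ++ v) k' q',
    qg q' = qg q ++ w & weak k w k'].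
Proof.
move=> rkq.
pose J v (c : state C) := exists k' q' w, [/\ c = (Some k', Exit q'),
  reached (r ++ v) k' q', qg q' = qg q ++ w & weak k w k'].
have H := @weak_invariant _ C J _ [::] (Some k, Exit q) v c.
apply: H => [{v c} u _ y [x t] [k' [q' [w [-> [qr qi kq] qw kk']]]]|]; last first.
  by exists k, q, [::]; rewrite !cats0; split=> //; exact: weak0.
rewrite /J; case: y => [a|] /=.
  case: t => [s r'|r' u'|q''] [_ /= ->] // /(qtP qi)[qi' qr' qu'].
  exists k', q'', w; split=> //; last by rewrite qu' cats0.
  by split; rewrite ?qu' ?cats0 // qr' qr catA.
rewrite cats0 => -[[/= ->]|[] /=|[b [/=]]].
- case: t => [//|//|q'' /(qtP qi)[qi' qr' qu']].
  exists k', q'', w; split=> //; last by rewrite qu' cats0.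
  by split; rewrite ?qu' ?qr' ?cats0.
- case: x => // k'' kk'' ->; exists k'', q', w; split=> //; last exact: weak_tau_r kk' kk''.
  by split=> //; exact: weak_tau_r kq kk''.
case: x => // k'' kk''; case: t => [//|//|q'' /(qtP qi)[qi' qr' qu']].
exists k'', q'', (w ++ [:: b]); split=> //.
- by split; rewrite ?qr' ?cats0 // qu'; exact: weak_rcons kq kk''.
- by rewrite qu' qw catA.
exact: weak_rcons kk' kk''.
Qed.

Lemma walk_weak x r u v c : @weak _ C (x, Walk r u) v c ->
  match c.2 with Follow _ _ => False | Walk _ _ => v = [::] | Exit _ => True end.
Proof.
pose J v (c : state C) :=
  match c.2 with Follow _ _ => False | Walk _ _ => v = [::] | Exit _ => True end.
have H := @weak_invariant _ C J _ [::] (x, Walk r u) v c.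
apply: H => // {x r u v c} u [x [//|r v|q]] y [x' t']; rewrite /J /=.
  move=> ->; case: y => [a|] /=.
    by case: t' => [s' r'|r' v'|//] [_ _] //= [_ [? []]].
  by case: t' => [s' r'|//|//] [[_ []]|[_ ]|[b [_ []]]].
move=> _; case: y => [a|] /=; first by case: t' => [s' r'|r' v'|//] [_ _ []].
by case: t' => [s' r'|r' v'|//] [[_ []]|[_ ]|[b [_ []]]].
Qed.

Lemma follow_weak x s r v x' s' r' :
  @weak _ C (x, Follow s r) v (x', Follow s' r') -> weak s v s'.
Proof.
pose J v (c : state C) := if c.2 is Follow s' _ then weak s v s' else True.
have H := @weak_invariant _ C J _ [::] (x, Follow s r) v (x', Follow s' r').
move=> h; apply: (H _ _ h); last exact: weak0.
move=> {v x' s' r' H h} v [y t] z [y' t']; rewrite /J /=.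
case: t => [s1 r1|r1 u|q]; case: t' => [s2 r2|//|//].
- move=> ss1; case: z => [a|] /=.
    move=> [_ _ [[b|] [zE s12 _]]]; last by discriminate zE.
    by case: zE s12 => <- s12; exact: weak_rcons ss1 s12.
  rewrite cats0 => -[[_ [[b|] [zE s12 _]]]|[_ [-> _]]|[b [_ [[?|] []]]]] //.
  exact: weak_tau_r ss1 s12.
- by case: z => [a|] /= _; [move=> [_ _ []]|move=> [[_ []]|[_ ]|[b [_ []]]]].
by case: z => [a|] /= _; [move=> [_ _ []]|move=> [[_ []]|[_ ]|[b [_ []]]]].
Qed.

(** The states just after the letters are considered. A walk shows no letter, so if one of them is
    in a walk, the next one is in the second phase; otherwise all of them follow [L], or one is
    already in the second phase. *)
Lemma ext_Inf xi : Inf C xi -> Inf L xi \/ exists i k q, reached (prefix_of xi i) k q /\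
  @weak_inf _ C (Some k, Exit q) (fun j => xi (i + j)).
Proof.
move=> /InfP/weak_inf_blocks[c [c0 cP]].
have cr i : ext_inv (prefix_of xi i) (c i).
  by apply: ext_reach; rewrite -c0; exact: blocks_weak.
have [[i [q iq]]|nE] := EM (exists i q, (c i).2 = Exit q).
  right; have := cr i; rewrite /ext_inv iq => -[k [ik kr]].
  exists i, k, q; split=> //.
  apply: (@weak_inf_coind _ C (fun m s => s = c (i + m))).
    by move=> m _ ->; exists (c (i + m.+1)); split=> //; rewrite addnS.
  by rewrite addn0; case: (c i) iq ik => /= ? ? -> ->.
left; have cF i : exists s, c i = (None, Follow s (prefix_of xi i)).
  have := cr i; rewrite /ext_inv; case ci: (c i) => [y [s r|r u|q]] /=;
    last by case: nE; exists i, q; rewrite ci.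
    by move=> [-> -> _]; exists s.
  have := sblock_weak (cP i); rewrite ci => /walk_weak; case ci': (c i.+1) => [y' [//|//|q]].
  by case: nE; exists i.+1, q; rewrite ci'.
have [s sP] := choice cF; apply/InfP.
have -> : init L = s 0 by have := sP 0; rewrite c0 => -[].
by apply: weak_inf_weak => i; have := sblock_weak (cP i); rewrite !sP => /follow_weak.
Qed.

Lemma ext_Div_eq :
  (forall r k q, reached r k q -> @diverges _ C (Some k, Exit q) -> Div L r) ->
  Div C = Div L.
Proof.
move=> h; apply/predeqP => r; split; last exact: ext_Div_base.
by move=> /ext_Div[//|[k [q [/h]]]].
Qed.

Lemma ext_nF_eq : Div C = Div L ->
  (forall r A k q, reached r k q -> A `<=` alphabet L -> ~ Div L r ->
    @stable _ C (Some k, Exit q) ->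
    (forall a, A a -> forall c, ~ @trans _ C (Some k, Exit q) (Some a) c) ->
    Sf L (r, A)) ->
  nF C = nF L.
Proof.
move=> DE h; apply/predeqP => -[r A]; rewrite /nF /= DE; split=> -[S nD]; split=> //.
  have [AL [//|[]//|[k [q [rkq sq qA]]]]] := ext_Sf S.
  exact: h rkq _ _ _ _.
exact: ext_Sf_base.
Qed.

Lemma ext_Inf_eq :
  (forall xi i k q, reached (prefix_of xi i) k q ->
    @weak_inf _ C (Some k, Exit q) (fun j => xi (i + j)) -> Inf L xi) ->
  Inf C = Inf L.
Proof.
move=> h; apply/predeqP => xi; split; last exact: ext_Inf_base.
by move=> /ext_Inf[//|[i [k [q [/h]]]]]; apply.
Qed.

End Extension.

Arguments Follow {Act L Q}.
Arguments Walk {Act L Q}.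
Arguments Exit {Act L Q}.

(** * Saturations forced by the congruence *)

Section Saturation.
Variables (Act : Type) (cong : LTS Act -> LTS Act -> Prop).
Hypotheses (Act_infinite : infinite_set [set: Act]) (cong_congr : congruence cong)
  (cong_cffd : forall L L', cffd_equiv L L' -> cong L L') (cong_VB : cong V B).
Implicit Types (L K : LTS Act) (r u v : seq Act).

Lemma cong_sym L L' : cong L L' -> cong L' L.
Proof. by have [[_ h _] _ _ _ _ _] := cong_congr; exact: h. Qed.

Lemma cong_trans L2 L1 L3 : cong L1 L2 -> cong L2 L3 -> cong L1 L3.
Proof. by have [[_ _ h] _ _ _ _ _] := cong_congr; exact: h. Qed.

Lemma some_action : exists d : Act, True.
Proof.
by apply: contrapT => h; apply: Act_infinite; rewrite (_ : setT = set0) //;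
  apply/predeqP => d; split=> // _; apply: h; exists d.
Qed.

(** * Irrelevance of stable failures at divergent traces *)

Section DivergentFailures.
Variables (L : LTS Act) (d : Act).
(** The type of second-phase states is empty: once [K] has been started, nothing but [K] can
    move. *)
Local Notation ext0 := (@extension Act L d False (fun _ _ _ => False) (fun _ _ _ => False)).
Let qo (q : False) : seq Act := match q with end.

Let exitP r u (q : False) : Div L r -> False -> [/\ True, qo q = r & qo q = u].
Proof. by []. Qed.

Let qtP (q : False) (y : option (Act + Act)) (q' : False) : True -> False -> [/\ True,
  qo q' = qo q ++ (if y is Some (inl a) then [:: a] else [::]) &
  qo q' = qo q ++ (if y is Some (inr x) then [:: x] else [::])].
Proof. by []. Qed.

(** The silent loop of [V] makes every walk state unstable, so nothing is added. *)
Lemma ext0_cffd_V : cffd_equiv L (ext0 V).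
Proof.
split=> //.
- apply/predeqP => -[r A]; split; first exact: ext_Sf_base.
  move=> /(ext_Sf exitP qtP)[_ [//|[_ [u [k [sc _]]]]|[_ []//]]].
  case: (sc (Some k, Walk r u)); exact: comp_trans_hidden.
- apply/esym; apply: (ext_Div_eq exitP qtP) => r k [].
- apply/esym; apply: (ext_Inf_eq exitP qtP) => xi i k [].
Qed.

(** [B] can silently reach its deadlocked state [true], which contributes every refusal set at every
    divergent trace of [L]. *)
Lemma ext0_B : [/\ Div (ext0 B) = Div L, Inf (ext0 B) = Inf L &
  Sf (ext0 B) = nF L `|` [set f | Div L f.1 /\ f.2 `<=` alphabet L]].
Proof.
split; first by apply: (ext_Div_eq exitP qtP) => r k [].
  by apply: (ext_Inf_eq exitP qtP) => xi i k [].
apply/predeqP => -[r A]; split.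
  move=> /(ext_Sf exitP qtP)[AL [SA|[Dr _]|[_ []//]]]; last by right.
  by have [Dr|nDr] := EM (Div L r); [right|left].
move=> [[SA _]|[/= Dr AL]]; first exact: ext_Sf_base.
apply/SfP; split=> //; exists (Some true, Walk r [::]); split.
- by apply: ext_walk Dr _; exact: (@weak_tau _ B).
- move=> [x t] /= [[_]|[+ _]|[b [/= + _]]].
  + by case: t => [//|r' u' [_ [? []]]|q []].
  + by case: x => // ? [].
  + by case: x => // ? [].
- by move=> a _ [x t] [_ _] /=; case: t => [//|r' u' [_ [? []]]|q []].
Qed.

End DivergentFailures.

(** [L] is CFFD-equivalent to its extension by [V], hence congruent to its extension by [B], which
    has forgotten the stable failures of [L] at divergent traces. *)
Lemma cong_nF L L' : alphabet L = alphabet L' -> nF L = nF L' -> Div L = Div L' ->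
  Inf L = Inf L' -> cong L L'.
Proof.
move=> AE FE DE IE; have [d _] := some_action.
have toB M : cong M (@extension Act M d False (fun _ _ _ => False) (fun _ _ _ => False) B).
  apply: cong_trans (cong_cffd (ext0_cffd_V M d)) _.
  exact: extension_cong.
apply: cong_trans (toB L) (cong_trans _ (cong_sym (toB L'))).
have [D1 I1 S1] := ext0_B L d; have [D2 I2 S2] := ext0_B L' d.
by apply: cong_cffd; split; rewrite ?D1 ?D2 ?I1 ?I2 ?S1 ?S2 ?DE ?FE ?AE.
Qed.

(** The extension by [K'] adds nothing to [L], so [L] is congruent to it by [cong_nF], and it is
    congruent to the extension by [K]. *)
Lemma extension_cong_from L d Q exit (qt : tester Act Q) K K' :
  alphabet K = alphabet K' -> cong K K' ->
  [/\ Div (extension L d exit qt K') = Div L,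
      nF (extension L d exit qt K') = nF L &
      Inf (extension L d exit qt K') = Inf L] ->
  cong L (extension L d exit qt K).
Proof.
move=> AE KK' [DE FE IE]; apply: (@cong_trans (extension L d exit qt K')).
  exact: cong_nF.
by apply: extension_cong => //; exact: cong_sym.
Qed.

(** * Chaos after divergence, from a trace that is not preserved *)

Section Chaos.
Variables (L : LTS Act) (d : Act) (sigma : seq Act).

Definition chaos_exit r u (q : seq Act) := u = sigma /\ q = r.
Definition chaos_tester : tester Act (seq Act) := fun q y q' =>
  match y with
  | Some (inl a) => alphabet L a /\ q' = rcons q a
  | Some (inr _) => False
  | None => q' = q
  end.

Let exitP r u q : Div L r -> chaos_exit r u q -> [/\ extT L q, id q = r & sigma = u].
Proof. by move=> Dr [-> ->]; split=> //; exact: extT_Div. Qed.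

Let qtP q y q' : extT L q -> chaos_tester q y q' -> [/\ extT L q',
  id q' = id q ++ (if y is Some (inl a) then [:: a] else [::]) &
  sigma = sigma ++ (if y is Some (inr x) then [:: x] else [::])].
Proof.
case: y => [[a|//]|] Eq; last by move=> ->; rewrite !cats0.
move=> [La ->]; rewrite cats0 cats1; split=> //; rewrite -cats1; apply: extT_cat => //.
by apply/word_cat; split; [case: Eq|apply: List.Forall_cons => //].
Qed.

Local Notation C := (extension L d chaos_exit chaos_tester).

Lemma chaos_unreached K : ~ Tr K sigma ->
  [/\ Div (C K) = Div L, nF (C K) = nF L & Inf (C K) = Inf L].
Proof.
move=> nT; have nr r k q : ~ @reached _ _ id (fun _ => sigma) (extT L) K r k q.
  by move=> [_ _ h]; apply: nT; apply/TrP; exists k.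
have DE : Div (C K) = Div L by apply: (ext_Div_eq exitP qtP) => r k q /nr.
split=> //; first by apply: (ext_nF_eq exitP qtP) => // r A k q /nr.
by apply: (ext_Inf_eq exitP qtP) => xi i k q /nr.
Qed.

(** Chaos can be entered at the minimal divergent prefix of any word in [extT L], perform the rest
    and diverge by its silent loop. It is entered only at divergent traces, so outside [extT L]
    nothing changes. *)
Lemma chaos_reached K : Tr K sigma ->
  [/\ Div (C K) = extT L, nF (C K) = anF L & Inf (C K) = Inf L `|` extI L].
Proof.
move=> /TrP[k sk].
have run q v : word L v -> @weak _ (C K) (Some k, Exit q) v (Some k, Exit (q ++ v)).
  elim: v q => [|a v IH] q; first by rewrite cats0 => _; exact: weak0.
  move=> /List.Forall_cons_iff[La Lv]; rewrite -cat_rcons.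
  by apply: (@weak_cons _ (C K) _ (Some a) _ _ _ _ (IH (rcons q a) Lv)); split.
have reach r : extT L r -> weak (init (C K)) r (Some k, Exit r).
  move=> [Lr [i [ir [Di _]]]].
  have e : chaos_exit (take i r) sigma (take i r) by [].
  have := weak_cat (@ext_exit _ _ d _ _ chaos_tester _ _ _ _ _ Di sk e) (run _ (drop i r) _).
  rewrite cat_take_drop; apply.
  by move: Lr; rewrite -{1}(cat_take_drop i r) => /word_cat[].
have DE : Div (C K) = extT L.
  apply/predeqP => r; split.
    by move=> /(ext_Div exitP qtP)[/extT_Div|[? [q [[<-]]]]].
  move=> Er; apply/DivP; exists (Some k, Exit r); split; first exact: reach.
  apply: (@diverges_coind _ (C K) (fun c => c = (Some k, Exit r))) => // c ->.
  by exists (Some k, Exit r); split=> //; exact: comp_trans_tau.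
split=> //.
  apply/predeqP => -[r A]; rewrite /nF /anF /= DE; split=> -[S nE]; split=> //.
    have [_ [//|[/extT_Div//]|[? [q [[/= qr Eq _] _ _]]]]] := ext_Sf exitP qtP S.
    by case: nE; rewrite -qr.
  exact: ext_Sf_base.
apply/predeqP => xi; split.
  move=> xiC; have [Lxi _] := xiC.
  have [|[i [? [q [[/= qr Eq _] _]]]]] := ext_Inf exitP qtP xiC; [by left|right].
  move: Eq; rewrite qr => -[_ [j [ji mj]]]; split=> //; exists j.
  by move: ji mj; rewrite size_prefix_of => /take_prefix_of ->.
move=> [xiL|[Lxi [i mi]]]; first exact: ext_Inf_base.
apply: (@Inf_words _ (C K) (fun m => (Some k, Exit (prefix_of xi (i + m)))) (addn i)).
- rewrite addn0; apply: reach; apply: extT_Div; by case: mi.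
- by move=> m; rewrite addnS.
- by move=> m; exists m; rewrite leq_addl.
move=> m; rewrite addnS prefix_of_step prefix_ofS -cats1.
by apply: run; apply: List.Forall_cons.
Qed.

End Chaos.

Lemma cong_chaos K K' sigma : cong K K' -> alphabet K = alphabet K' ->
  Tr K sigma -> ~ Tr K' sigma -> forall L, exists L1,
  [/\ cong L L1, alphabet L1 = alphabet L, Div L1 = extT L, nF L1 = anF L &
      Inf L1 = Inf L `|` extI L].
Proof.
move=> KK' AE TK nTK' L; have [d _] := some_action.
exists (extension L d (chaos_exit sigma) (chaos_tester L) K).
have [? ? ?] := chaos_reached L d TK.
by split=> //; apply: (extension_cong_from AE KK'); exact: chaos_unreached.
Qed.

(** * A second copy of the system, from a divergence or a failure that is not preserved *)

Section Copy.
Variables (L : LTS Act) (d : Act) (sigma : seq Act) (offer : Prop) (A : set Act).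

(* A copy of [L], running while [K] rests after [sigma]; it may stop to insist on
   a joint action in [A], which makes the stable failures of [K] visible. *)
Inductive phase := Copying | Offering | Accepted (a : Act).
Notation Q := (phase * state L * seq Act)%type.

(** The copy may start in any state that [L] reaches by [r], diverging or not, so that it can
    continue with every trace of [L] extending [r]. *)
Definition copy_exit r u (q : Q) :=
  let: (p, s, r') := q in [/\ p = Copying, u = sigma, r' = r & weak (init L) r s].

Definition copy_step (s : state L) r (y : option (Act + Act)) (s' : state L) r' :=
  exists x, [/\ y = omap inl x, trans s x s' & r' = r ++ lbl x].

Definition copy_tester : tester Act Q := fun q y q' =>
  let: (p, s, r) := q in let: (p', s', r') := q' in
  match p, p' with
  | Copying, Copying => copy_step s r y s' r'
  | Copying, Offering => [/\ offer, y = None, s' = s & r' = r]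
  | Offering, Accepted a => [/\ A a, y = Some (inr a), s' = s & r' = r]
  | Accepted a, Accepted a' => a' = a /\ copy_step s r y s' r'
  | _, _ => False
  end.

Let qo (q : Q) := q.2.
Let qg (q : Q) := if q.1.1 is Accepted a then rcons sigma a else sigma.
Let qinv (q : Q) := [/\ extT L q.2, weak (init L) q.2 q.1.2 &
  match q.1.1 with Copying => True | Offering => offer | Accepted a => A a end].

Let exitP r u q : Div L r -> copy_exit r u q -> [/\ qinv q, qo q = r & qg q = u].
Proof.
case: q => -[p s] r' Dr [-> -> -> rs]; split=> //; split=> //; exact: extT_Div.
Qed.

Let stepP s r y s' r' : extT L r -> weak (init L) r s -> copy_step s r y s' r' ->
  [/\ extT L r', weak (init L) r' s',
    r' = r ++ (if y is Some (inl a) then [:: a] else [::]) &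
    [::] = (if y is Some (inr x) then [:: x] else [::])].
Proof.
move=> Er rs [x [-> ss' ->]]; have rs' := weak_rcons rs ss'.
split=> //; [exact: extT_cat Er (weak_word rs')|by case: x {ss' rs'}..].
Qed.

Let qtP q y q' : qinv q -> copy_tester q y q' -> [/\ qinv q',
  qo q' = qo q ++ (if y is Some (inl a) then [:: a] else [::]) &
  qg q' = qg q ++ (if y is Some (inr x) then [:: x] else [::])].
Proof.
case: q => -[p s] r; case: q' => -[p' s'] r' [/= Er rs pA].
case: p p' pA => [||a] [||a'] //= pA.
- by move=> /(stepP Er rs)[Er' rs' r'E <-]; rewrite cats0.
- by move=> [? -> -> ->]; rewrite !cats0.
- by move=> [Aa' -> -> ->]; rewrite cats0 cats1.
- by move=> [-> /(stepP Er rs)[Er' rs' r'E <-]]; rewrite cats0.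
Qed.

Local Notation C := (extension L d copy_exit copy_tester).
Local Notation reached := (reached qo qg qinv).

Lemma copy_follow K k p s r v c : @weak _ (C K) (Some k, Exit (p, s, r)) v c ->
  exists k' p' s' r', c = (Some k', Exit (p', s', r')) /\ weak s v s'.
Proof.
pose J v (c : state (C K)) :=
  exists k' p' s' r', c = (Some k', Exit (p', s', r')) /\ weak s v s'.
have H := @weak_invariant _ (C K) J _ [::] (Some k, Exit (p, s, r)) v c.
apply: H; last by exists k, p, s, r; split=> //; exact: weak0.
move=> u _ y [x t] [k' [p' [s' [r' [-> ss']]]]]; rewrite /J.
have stepJ r1 s2 r2 z : copy_step s' r1 z s2 r2 ->
    weak s (u ++ (if z is Some (inl a) then [:: a] else [::])) s2.
  by move=> [w [-> s's2 _]]; have := weak_rcons ss' s's2; case: w {s's2}.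
case: y => [a|] /=.
  case: t => [? ?|? ?|[[p2 s2] r2]] [_ /= -> h] //; exists k', p2, s2, r2; split=> //.
  case: p' p2 h => [||a1] [||a2] //=; [exact: stepJ|by move=> []|by move=> []|].
  by move=> [_]; exact: stepJ.
rewrite cats0 => -[[/= ->]|[] /=|[b [/=]]].
- case: t => [//|//|[[p2 s2] r2]] h; exists k', p2, s2, r2; split=> //.
  have stepJ0 z : copy_step s' r' None z r2 -> weak s u z.
    by move/stepJ; rewrite cats0.
  case: p' p2 h => [||a1] [||a2] //=; [exact: stepJ0|by move=> [_ _ ->]|by move=> []|].
  by move=> [_]; exact: stepJ0.
- by case: x => // k2 _ ->; exists k2, p', s', r'.
case: x => // k2 _; case: t => [//|//|[[p2 s2] r2]] h; exists k2, p2, s2, r2; split=> //.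
have stepJ0 z : copy_step s' r' (Some (inr b)) z r2 -> weak s u z.
  by move/stepJ; rewrite cats0.
case: p' p2 h => [||a1] [||a2] //=; [exact: stepJ0|by move=> []|by move=> [_ _ ->]|].
by move=> [_]; exact: stepJ0.
Qed.

Lemma copy_Inf K : Inf (C K) = Inf L.
Proof.
apply: (ext_Inf_eq exitP qtP) => xi i k [[p s] r] [/= rE [_ rs _] _].
move=> /weak_inf_blocks[c [c0 cP]].
have /choice[f fP] : forall m, exists s', exists k' p' r', c m = (Some k', Exit (p', s', r')).
  move=> m; have := blocks_weak m cP.
  by rewrite c0 => /copy_follow[k' [p' [s' [r' [-> _]]]]]; exists s', k', p', r'.
rewrite /= rE in rs; apply: Inf_cat rs _.
have -> : s = f 0 by have [? [? [? ]]] := fP 0; rewrite c0 => -[].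
apply: weak_inf_weak => m; have [k1 [p1 [r1 c1]]] := fP m.
have := sblock_weak (cP m); rewrite c1 => /copy_follow[k2 [p2 [s2 [r2 [c2 ?]]]]].
have [k3 [p3 [r3]]] := fP m.+1; rewrite c2 => -[_ _ <- _]; exact.
Qed.

(** The phases are treated in the order [Accepted], [Offering], [Copying], since each can only lead
    to earlier ones in this list. While the copy runs, an induction on the silent steps of [L]
    encloses one on those of [K]; during the offer [L] is frozen and the latter suffices. *)
Lemma copy_tau_wf K k p s r : ~ Div K sigma -> (forall a, A a -> ~ Div K (rcons sigma a)) ->
  reached r k (p, s, r) -> tau_wf s -> @tau_wf _ (C K) (Some k, Exit (p, s, r)).
Proof.
move=> nDs nDa; rewrite /reached => -[_ [_ _ pA] kq] ws.
have wf u k' : ~ Div K u -> weak (init K) u k' -> tau_wf k'.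
  by move=> nDu uk'; apply/tau_wfP => dk'; apply: nDu; apply/DivP; exists k'.
have wfA a k' s' r' : A a -> weak (init K) (rcons sigma a) k' -> tau_wf s' ->
    @tau_wf _ (C K) (Some k', Exit (Accepted a, s', r')).
  move=> Aa ak' ws'; elim: ws' k' r' ak' => {}s' _ IHs k' r' ak'.
  have wk' := wf _ _ (nDa _ Aa) ak'; elim: wk' ak' => {}k' _ IHk ak'.
  apply: Acc_intro => -[x t] /= [[->]|[kk' ->]|[b [_]]].
  - case: t => [? ?|? ?|[[[||a'] s2] r2]] h; try exact: (False_ind _ h).
    move: h => [-> [[?|] [zE ss2 ->]]]; first by discriminate zE.
    exact: IHs.
  - case: x kk' => [k2 kk2|[]]; apply: IHk => //; exact: weak_tau_r ak' kk2.
  - case: t => [? ?|? ?|[[[||a'] s2] r2]] h; try exact: (False_ind _ h).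
    by move: h => [_ [[z|] []]].
have wfO k' s' r' : weak (init K) sigma k' -> tau_wf s' ->
    @tau_wf _ (C K) (Some k', Exit (Offering, s', r')).
  move=> ks ws'; have wk' := wf _ _ nDs ks; elim: wk' ks => {}k' _ IHk ks.
  apply: Acc_intro => -[x t] /= [[->]|[kk' ->]|[b [kk']]].
  - case: t => [? ?|? ?|[[[||a'] s2] r2]] h; try exact: (False_ind _ h).
    by move: h => [].
  - case: x kk' => [k2 kk2|[]]; apply: IHk => //; exact: weak_tau_r ks kk2.
  case: x kk' => [k2 kk2|[]]; case: t => [? ?|? ?|[[[||a'] s2] r2]] h; try exact: (False_ind _ h).
  move: h => [Aa' [bE] -> _]; subst b; apply: wfA; [exact: Aa'| |exact: ws'].
  rewrite -cats1; exact: weak_rcons ks kk2.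
case: p pA kq => [||a] pA kq; [|by apply: wfO|by apply: wfA].
clear pA; elim: ws k r kq => {}s ws IHs k r kq; have wk := wf _ _ nDs kq; elim: wk kq => {}k _ IHk kq.
apply: Acc_intro => -[x t] /= [[->]|[kk' ->]|[b [_]]].
- case: t => [? ?|? ?|[[[||a'] s2] r2]] h; try exact: (False_ind _ h).
    move: h => [[?|] [zE ss2 ->]]; first by discriminate zE.
    exact: IHs.
  move: h => [_ _ -> ->]; apply: wfO; [exact: kq|exact: Acc_intro].
- case: x kk' => [k2 kk2|[]]; apply: IHk => //; exact: weak_tau_r kq kk2.
- case: t => [? ?|? ?|[[[||a'] s2] r2]] h; try exact: (False_ind _ h).
    by move: h => [[z|] []].
  by move: h => [].
Qed.

Lemma copy_Div K : ~ Div K sigma -> (forall a, A a -> ~ Div K (rcons sigma a)) ->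
  Div (C K) = Div L.
Proof.
move=> nDs nDa; apply: (ext_Div_eq exitP qtP) => r k [[p s] r'] rkq dc.
case: (rkq) => /= rE [_ rs _] _; rewrite /= rE in rs dc; subst r'.
apply: contrapT => nDr; move: dc; apply/tau_wfP.
apply: (copy_tau_wf nDs nDa rkq); apply/tau_wfP => ds.
by apply: nDr; apply/DivP; exists s.
Qed.

(** When copying or after acceptance every move of [L] is available, so a stable failure there is
    one of [L]. A stable offer means that [K] is stable after [sigma] and refuses all of [A]. *)
Lemma copy_Sf K r B : Sf (C K) (r, B) ->
  [\/ Sf L (r, B), Div L r |
    [/\ extT L r, Tr L r, offer & A `<=` alphabet K -> Sf K (sigma, A)]].
Proof.
move=> /(ext_Sf exitP qtP)[BL [SB|[Dr _]|[k [[[p s] r'] [[/= rE [/= Er rs pA] kq] sc cB]]]]].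
- exact: Or31.
- exact: Or32.
rewrite rE in Er rs.
have follows : (forall z s2, trans s z s2 -> exists q, copy_tester (p, s, r') (omap inl z) q) ->
    Sf L (r, B).
  move=> h; apply/SfP; split=> //; exists s; split=> // [s2 ss2|a Ba s2 ss2].
    by have [q pq] := h _ _ ss2; apply: (sc (Some k, Exit q)); exact: comp_trans_tau.
  have [q pq] := h _ _ ss2; apply: (cB a Ba (Some k, Exit q)).
  by split=> //; exact: BL.
case: p pA kq sc cB follows => [||a] pA kq sc cB follows.
- apply: Or31; apply: follows => z s2 ss2; exists (Copying, s2, r' ++ lbl z).
  by exists z.
- apply: Or33; split=> //; first by apply/TrP; exists s.
  move=> AK; apply/SfP; split=> //; exists k; split=> // [k2 kk2|a Aa k2 kk2].
    by apply: (sc (Some k2, Exit (Offering, s, r'))); exact: comp_trans_hidden.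
  apply: (sc (Some k2, Exit (Accepted a, s, r'))).
  exact: (@comp_trans_sync _ (act_prefix d K) _ _ _ _ _ _ a).
apply: Or31; apply: follows => z s2 ss2; exists (Accepted a, s2, r' ++ lbl z).
by split=> //; exists z.
Qed.

(** A path of [L] along [r] is cut at the minimal divergent prefix of [r]; the copy is entered in
    the state where the cut is made. *)
Lemma copy_reach K k r s : weak (init K) sigma k -> extT L r -> weak (init L) r s ->
  weak (init (C K)) r (Some k, Exit (Copying, s, r)).
Proof.
move=> ks [Lr [i [ir [Di _]]]]; rewrite -{1}(cat_take_drop i r) => /weak_catP[s0 [rs0 s0s]].
have e : copy_exit (take i r) sigma (Copying, s0, take i r) by [].
have run q : @weak _ (C K) (Some k, Exit (Copying, s0, q)) (drop i r)
    (Some k, Exit (Copying, s, q ++ drop i r)).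
  move: s0 (drop i r) s0s q {rs0 e}; apply: weak_ind_l => [q|s0 x s1 u s01 _ IH q].
    by rewrite cats0; exact: weak0.
  rewrite catA; apply: (@weak_cons _ (C K) _ x (Some k, Exit (Copying, s1, q ++ lbl x))) => //.
  case: x s01 => [a|] s01; first by split=> //; [exact: trans_alphabet s01|exists (Some a)].
  by apply: comp_trans_tau; exists None.
have := weak_cat (@ext_exit _ _ d _ _ copy_tester _ _ _ _ _ Di ks e) (run _).
by rewrite cat_take_drop.
Qed.

(** [K] supplies the divergence while the copy rests in any state it has reached. *)
Lemma copy_Div_extT K : Div K sigma -> Div (C K) = extT L `&` Tr L.
Proof.
move=> /DivP[k [ks dk]]; apply/predeqP => r; split.
  move=> /(ext_Div exitP qtP)[Dr|[k' [[[p s] r'] [[/= <- [Er rs _] _] _]]]].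
    by split; [exact: extT_Div|exact: Div_Tr].
  by split=> //; apply/TrP; exists s.
move=> [Er /TrP[s rs]]; apply/DivP; exists (Some k, Exit (Copying, s, r)).
split; first exact: copy_reach.
apply: (@diverges_coind _ (C K) (fun c => exists k', diverges k' /\
  c = (Some k', Exit (Copying, s, r)))); last by exists k.
move=> _ [k1 [/diverges_inv[k2 [k12 dk2]] ->]].
exists (Some k2, Exit (Copying, s, r)); split; last by exists k2.
exact: comp_trans_hidden.
Qed.

End Copy.

Lemma cong_divergences K K' sigma : cong K K' -> alphabet K = alphabet K' ->
  Div K sigma -> ~ Div K' sigma -> forall L, exists L1,
  [/\ cong L L1, alphabet L1 = alphabet L, Div L1 = extT L `&` Tr L, nF L1 = anF L &
      Inf L1 = Inf L].
Proof.
move=> KK' AE DK nDK' L; have [d _] := some_action.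
(* Offers are switched off: only the divergence of [K] after [sigma] is to become visible. *)
pose C := extension L d (@copy_exit L sigma) (@copy_tester L False set0).
have nD0 a : @set0 Act a -> ~ Div K' (rcons sigma a) by [].
have DE : Div (C K) = extT L `&` Tr L by exact: copy_Div_extT.
have DE' : Div (C K') = Div L by exact: copy_Div.
exists (C K); split=> //; last exact: copy_Inf.
  apply: (extension_cong_from AE KK'); split=> //; last exact: copy_Inf.
  apply/predeqP => -[r B]; rewrite /nF /= DE'; split=> -[S nD]; split=> //.
    by case: (copy_Sf S) => // -[].
  exact: ext_Sf_base.
apply/predeqP => -[r B]; rewrite /nF /anF /= DE; split=> -[S nD]; split=> //.
- by case: (copy_Sf S) => [//|Dr|[]//]; case: nD; split; [exact: extT_Div|exact: Div_Tr].
(* Any stable failure of the extension by [K] occurs at a trace of [L]; if this trace were in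
   [extT L], it would be divergent. *)
- by move=> Er; apply: nD; split=> //; case: (copy_Sf S) => [/Sf_Tr|/Div_Tr|[]].
- exact: ext_Sf_base.
by move=> [].
Qed.

(** After [sigma], [K] can be stable and refuse [A], so the offer deadlocks and yields all refusal
    sets; [K'] cannot, so its offer is never stable. That neither diverges after [sigma] or after
    [sigma] followed by an action of [A] prevents new divergences, which is why [snF] is the
    relevant set. *)
Lemma cong_failures K K' sigma A : cong K K' -> alphabet K = alphabet K' ->
  snF K (sigma, A) -> ~ Sf K' (sigma, A) -> ~ Div K' sigma ->
  (forall a, A a -> ~ Div K' (rcons sigma a)) ->
  forall L, exists L1,
  [/\ cong L L1, alphabet L1 = alphabet L, Div L1 = Div L, Inf L1 = Inf L &
    nF L1 = [set f | [/\ ~ Div L f.1, f.2 `<=` alphabet L &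
                         Sf L f \/ extT L f.1 /\ Tr L f.1]]].
Proof.
move=> KK' AE [[/SfP[AK [k [sk kS kA]]] nDK] nDKa] nSK' nDK' nDKa' L; have [d _] := some_action.
pose C := extension L d (@copy_exit L sigma) (@copy_tester L True A).
have DE : Div (C K) = Div L by exact: copy_Div.
have DE' : Div (C K') = Div L by exact: copy_Div.
exists (C K); split=> //; last 2 first.
- exact: copy_Inf.
- apply/predeqP => -[r B]; rewrite /nF /= DE; split.
    move=> [S nD]; split=> //; first by case: (S).
    by case: (copy_Sf S) => [|//|[]]; [left|right].
  move=> [nD BL [SL|[Er /TrP[s rs]]]]; first by split=> //; exact: ext_Sf_base.
  split=> //; apply/SfP; split=> //; exists (Some k, Exit (Offering, s, r)); split.
  + apply: weak_tau_r (copy_reach d True A sk Er rs) _; exact: comp_trans_tau.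
  + move=> [x t] /= [[_]|[+ _]|[b [/=]]].
    * by case: t => [? ?|? ?|[[[||a'] s2] r2]] //= [].
    * by case: x => // k2 /kS.
    * move=> kb; case: t => [? ?|? ?|[[[||a'] s2] r2]] //= [Aa' [bE] _ _]; subst b.
      by case: x kb => [k2|//] kb; apply: (kA _ Aa' k2).
  move=> b Bb [x t] [_ _] /=.
  by case: t => [? ?|? ?|[[[||a'] s2] r2]] //= [].
apply: (extension_cong_from AE KK'); split=> //; last exact: copy_Inf.
apply/predeqP => -[r B]; rewrite /nF /= DE'; split=> -[S nD]; split=> //.
  by case: (copy_Sf S) => // -[_ _ _] h; case: nSK'; apply: h; rewrite -AE.
exact: ext_Sf_base.
Qed.

(** * Hops between divergent traces, from an infinite trace that is not preserved *)

Section Hop.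
Variables (L : LTS Act) (d : Act) (zeta : nat -> Act) (long : Prop) (N : set (seq Act)).
(** During a hop the trace may be non-divergent while everything is blocked; the failures arising
    there are required to be in [L] already. *)
Hypothesis saturated : forall r A, extT L r -> Tr L r -> ~ Div L r ->
  A `<=` alphabet L -> Sf L (r, A).

(* [Extend]: at a divergent trace [r] of [L], silently extend the trace [u] of [K];
   [Go]: perform the visible word [v] leading to the next divergent trace, while
   [K] rests after [u].  The length of [u] forces [K] through all of [zeta]. *)
Inductive hop :=
  | Extend (r u : seq Act)
  | Go (r u v : seq Act).

(** A long hop may pass non-divergent traces, so [K] must then rest after a trace in [N], meant to
    exclude its divergence. A one-letter hop passes from one divergent trace directly to another. *)
Definition hop_guard r u v := [/\ v <> [::], Div L (r ++ v),
  u = prefix_of zeta (size u), long -> N u & ~ long -> size v = 1].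

Definition hop_exit r u q := q = Extend r u.

Definition hop_tester : tester Act hop := fun q y q' =>
  match q, q' with
  | Extend r u, Extend r' u' => r' = r /\ exists x, y = Some (inr x) /\ u' = rcons u x
  | Extend r u, Go r' u' v => [/\ y = None, r' = r, u' = u & hop_guard r u v]
  | Go r u v, Extend r' u' =>
      [/\ v = [::], r' = r & exists x, y = Some (inr x) /\ u' = rcons u x]
  | Go r u v, Go r' u' v' =>
      exists a, [/\ y = Some (inl a), v = a :: v', r' = rcons r a & u' = u]
  end.

Let qo q := match q with Extend r u => r | Go r u v => r end.
Let qg q := match q with Extend r u => u | Go r u v => u end.
Let qinv q := match q with
  | Extend r u => Div L r
  | Go r u v => [/\ Div L (r ++ v), extT L r, u = prefix_of zeta (size u),
      long -> N u & ~ long -> size v <= 1 /\ Div L r]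
  end.

Let exitP r u q : Div L r -> hop_exit r u q -> [/\ qinv q, qo q = r & qg q = u].
Proof. by move=> Dr ->. Qed.

Let qtP q y q' : qinv q -> hop_tester q y q' -> [/\ qinv q',
  qo q' = qo q ++ (if y is Some (inl a) then [:: a] else [::]) &
  qg q' = qg q ++ (if y is Some (inr x) then [:: x] else [::])].
Proof.
case: q => [r u|r u v]; case: q' => [r' u'|r' u' v'] /=.
- by move=> Dr [-> [x [-> ->]]]; rewrite cats0 cats1.
- move=> Dr [-> -> -> [v0 Dv uE Nu sv]]; rewrite !cats0; split=> //; split=> //.
    exact: extT_Div.
  by move=> /sv ->.
- by move=> [Dv Er uE Nu sv] [vE -> [x [-> ->]]]; rewrite vE cats0 in Dv; rewrite cats0 cats1.
move=> [Dv Er uE Nu sv] [a [-> vE -> ->]]; subst v.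
rewrite cats0 cats1; split=> //; split=> //.
- by rewrite cat_rcons.
- rewrite -cats1; apply: extT_cat => //; have /Div_Tr/Tr_word := Dv.
  by rewrite -cat1s catA => /word_cat[].
- by move=> /sv[]; rewrite /= ltnS leqn0 => /nilP v'0 _; move: Dv; rewrite v'0 cats1.
Qed.

Local Notation C := (extension L d hop_exit hop_tester).
Local Notation reached := (reached qo qg qinv).

(** At a non-divergent trace the hop is long and unfinished, so only [K] can move silently; it rests
    after a trace in [N] and cannot do so forever. *)
Lemma hop_Div K : (long -> forall u, N u -> ~ Div K u) -> Div (C K) = Div L.
Proof.
move=> NK; apply: (ext_Div_eq exitP qtP) => r k [r' u|r' u v] [/= <- //] [Dv Er uE Nu sv] uk.
move=> dc; apply: contrapT => nDr; move: dc; apply/tau_wfP.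
have lo : long by apply: contrapT => /sv[].
have /tau_wfP wk : ~ diverges k.
  by move=> dk; apply: (NK lo u (Nu lo)); apply/DivP; exists k.
elim: wk {uk} => {}k _ IH; apply: Acc_intro => -[x t] /= [[_]|[+ ->]|[b [_]]].
- case: t => [? ?|? ?|[? ?|? ? ?]] h; try exact: (False_ind _ h).
    by move: h => [_ _ [? []]].
  by move: h => [? []].
- by case: x => [k' kk'|[]]; exact: IH.
case: t => [? ?|? ?|[? ?|? ? ?]] h; try exact: (False_ind _ h).
  by move: h => [v0 _]; case: nDr; move: Dv; rewrite v0 cats0.
by move: h => [? []].
Qed.

Lemma hop_nF K : (long -> forall u, N u -> ~ Div K u) -> nF (C K) = nF L.
Proof.
move=> NK; apply: (ext_nF_eq exitP qtP); first exact: hop_Div.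
move=> r A k [r' u|r' u v] [/= <-] // [Dv Er _ _ _] _ AL nD _ _.
by apply: saturated => //; apply: Tr_catl (Div_Tr Dv).
Qed.

(** Either the hop is still under way, having shown a prefix of [v], or it was completed: a
    divergent trace was visited and the trace of [K] became longer. *)
Lemma go_weak K k r u v w c : Div L (r ++ v) -> @weak _ (C K) (Some k, Exit (Go r u v)) w c ->
  exists k' q, c = (Some k', Exit q) /\
    ((exists r' v', q = Go r' u v' /\ v = w ++ v') \/
     size u < size (qg q) /\ exists w1 w2, w = w1 ++ w2 /\ Div L (r ++ w1)).
Proof.
move=> Dv; pose J w (c : state (C K)) := exists k' q, c = (Some k', Exit q) /\
    ((exists r' v', q = Go r' u v' /\ v = w ++ v') \/
     size u < size (qg q) /\ exists w1 w2, w = w1 ++ w2 /\ Div L (r ++ w1)).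
have H := @weak_invariant _ (C K) J _ [::] (Some k, Exit (Go r u v)) w c.
apply: H; last by exists k, (Go r u v); split=> //; left; exists r, v.
move=> {w c} w _ y [x t] [k' [q [-> h]]] tr; rewrite /J.
have [k2 [q2 [ct sync]]] : exists k2 q2, (x, t) = (Some k2, Exit q2) /\
    (q2 = q /\ y = None \/ exists z, hop_tester q z q2 /\
      y = (if z is Some (inl a) then Some a else None)).
  case: y tr => [a|] /=.
    by case: t => [? ?|? ?|q2] [_ /= -> h2] //; exists k', q2; split=> //; right; exists (Some (inl a)).
  move=> [[/= ->]|[] /=|[b [/=]]].
  - by case: t => // q2 h2; exists k', q2; split=> //; right; exists None.
  - by case: x => // k2 _ ->; exists k2, q; split=> //; left.
  by case: x => // k2 _; case: t => // q2 h2; exists k2, q2; split=> //; right; exists (Some (inr b)).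
clear tr; exists k2, q2; split; first exact: ct.
case: sync => [[-> ->]|[z [qz ->]]]; first by rewrite cats0.
have mono : size (qg q) <= size (qg q2).
  case: q q2 qz {h ct} => [? ?|? ? ?] [? ?|? ? ?] /=.
  - by move=> [_ [? [_ ->]]]; rewrite size_rcons.
  - by move=> [_ _ ->].
  - by move=> [_ _ [? [_ ->]]]; rewrite size_rcons.
  - by move=> [? [_ _ _ ->]].
case: h => [[r' [v' [qE vE]]]|[su [w1 [w2 [wE D1]]]]]; last first.
  right; split; first exact: leq_trans mono.
  by exists w1, (w2 ++ lbl (if z is Some (inl a) then Some a else None)); rewrite wE catA.
rewrite qE in qz; case: q2 qz {ct mono} => [r2 u2|r2 u2 v2] /=.
  move=> [v0 _ [a [-> ->]]]; right; rewrite size_rcons; split=> //.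
  by exists w, [::]; split=> //; move: Dv; rewrite vE v0 cats0.
move=> [a [-> v'E _ ->]]; left; exists r2, v2; split=> //.
by rewrite vE v'E /= -catA.
Qed.

Lemma visible_Go K (c : state (C K)) a x q : @trans _ (C K) c (Some a) (x, Exit q) ->
  exists r u v, q = Go r u v.
Proof.
case: c => x' t [_ /= _]; case: q => [r u|r u v]; last by exists r, u, v.
by case: t => [? ?|? ? []|[? ? [_ [? []]]|? ? ? [_ _ [? []]]]].
Qed.

(** Every hop is finite and is ended by a joint action, so in an infinite second phase the trace of
    [K] grows without bound. At each [Go] it is a prefix of [zeta], hence [K] performs [zeta]. Each
    completed hop visits a divergent prefix of [xi]. *)
Lemma hop_Inf_sub K xi : Inf (C K) xi -> Inf L xi \/
  [/\ Inf K zeta, forall M, exists j, M <= j /\ Div L (prefix_of xi j) &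
      ~ long -> exists n, forall j, n <= j -> Div L (prefix_of xi j)].
Proof.
move=> /(ext_Inf exitP qtP)[|[i [k [q [rq /weak_inf_blocks[c [c0 cP]]]]]]]; [by left|right].
have cr m : exists k' q', c m = (Some k', Exit q') /\ reached (prefix_of xi (i + m)) k' q'.
  have := blocks_weak m cP; rewrite c0 => /(exit_weak qtP rq)[k' [q' [w [cE rq' _ _]]]].
  by exists k', q'; rewrite prefix_ofD.
have /choice[f fP] : forall m, exists f : state K * seq Act * seq Act,
    c m.+1 = (Some f.1.1, Exit (Go (prefix_of xi (i + m.+1)) f.1.2 f.2)) /\
    reached (prefix_of xi (i + m.+1)) f.1.1 (Go (prefix_of xi (i + m.+1)) f.1.2 f.2).
  move=> m; have [k' [q' [cE rq']]] := cr m.+1; have [y [_ yc]] := cP m.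
  rewrite cE in yc; have [r [u [v qE]]] := visible_Go yc.
  have [/= rE _ _] := rq'; rewrite qE /= in rE.
  by exists (k', u, v); rewrite -rE -qE rE.
pose kk m := (f m).1.1; pose u m := (f m).1.2; pose v m := (f m).2.
have cweak m n : weak (c m) (prefix_of (fun j => xi (i + m + j)) n) (c (m + n)).
  rewrite -{1}(addn0 m).
  have := @blocks_weak _ (C K) (fun j => c (m + j)) (fun j => xi (i + m + j)) n; apply.
  by move=> j; rewrite addnS -addnA; exact: cP.
have fD m : Div L (prefix_of xi (i + m.+1) ++ v m) by have [_ [_ []]] := fP m.
have uE m : u m = prefix_of zeta (size (u m)) by have [_ [_ []]] := fP m.
(* The current hop has [size (v m)] letters left, so one letter more cannot fit into it. *)
have progress m : size (u m) < size (u (m + (size (v m)).+1)) /\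
    exists j, m <= j /\ Div L (prefix_of xi j).
  have := cweak m.+1 (size (v m)).+1; have [cE _] := fP m.
  rewrite cE => /(go_weak (fD m))[k' [q' [cE' h]]].
  have [cE2 _] := fP (m + (size (v m)).+1); rewrite addSn cE2 in cE'.
  case: cE' h => _ <- [[r' [v' [_ /(congr1 size)]]]|].
    rewrite size_cat size_prefix_of => h; have := leq_addr (size v') (size (v m)).+1.
    by rewrite -h ltnn.
  move=> [/= ltu [w1 [w2 [wE D1]]]]; split=> //.
  exists (i + m.+1 + size w1); split; first by rewrite addnS !addSn addnAC; exact: leqW (leq_addl _ _).
  rewrite prefix_ofD; move: D1; congr (Div L (_ ++ _)).
  have sw : size w1 <= (size (v m)).+1.
    by rewrite -(size_prefix_of (fun j => xi (i + m.+1 + j)) (size (v m)).+1) wE size_cat leq_addr.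
  by rewrite -(take_prefix_of _ sw) wE take_size_cat.
split; last first.
- move=> short; exists i.+1 => j ij; have [_ [_ [_ _ _ _ /(_ short)[_]]]] := fP (j - i.+1).
  by rewrite addnS -addSn subnKC.
- by move=> M; have [_] := progress M.
have step m : exists w, u m.+1 = u m ++ w /\ weak (kk m) w (kk m.+1).
  have [cE rm] := fP m; have [cE2 _] := fP m.+1.
  have := sblock_weak (cP m.+1); rewrite cE => /(exit_weak qtP rm)[k' [q' [w [cE' _ qw kw]]]].
  by move: cE'; rewrite cE2 => -[k'E q'E]; exists w; rewrite /kk k'E; split=> //; rewrite -qw -q'E.
have sM m n : size (u m) <= size (u (m + n)).
  elim: n => [|n IH]; first by rewrite addn0.
  have [w [uw _]] := step (m + n).
  by rewrite addnS uw size_cat (leq_trans IH) // leq_addr.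
apply: (@Inf_words _ K kk (fun m => size (u m))).
- by rewrite -uE; have [_ [_ _]] := fP 0.
- by move=> m; have := sM m 1; rewrite addn1.
- elim=> [|M [m Mm]]; first by exists 0.
  by exists (m + (size (v m)).+1); apply: leq_ltn_trans Mm _; have [] := progress m.
move=> m; have [w [uw kw]] := step m; move: kw; congr weak.
have e : prefix_of zeta (size (u m.+1)) = prefix_of zeta (size (u m)) ++ w.
  by rewrite -uE uw -uE.
have um : size (u m) <= size (u m.+1) by have := sM m 1; rewrite addn1.
move: e; rewrite (prefix_of_split _ um) => /(congr1 (drop (size (u m)))).
by rewrite !drop_size_cat ?size_prefix_of.
Qed.

Lemma hop_round K k k' r u v w : hop_guard r u v -> word L v -> w <> [::] -> weak k w k' ->
  @weak _ (C K) (Some k, Exit (Extend r u)) v (Some k', Exit (Extend (r ++ v) (u ++ w))).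
Proof.
move=> guard Lv w0 kw.
apply: (@weak_tau_l _ (C K) _ (Some k, Exit (Go r u v))); first exact: comp_trans_tau.
have glue := @weak_cat _ (C K) (Some k, Exit (Go r u v)) v (Some k, Exit (Go (r ++ v) u [::])) [::].
rewrite cats0 in glue; apply: glue.
  move: v r {guard} Lv; elim=> [|a v IH] r; first by rewrite cats0 => _; exact: weak0.
  move=> /List.Forall_cons_iff[La Lv]; rewrite -cat_rcons.
  apply: (@weak_cons _ (C K) _ (Some a) (Some k, Exit (Go (rcons r a) u v)) v); last exact: IH.
  by split=> //; exists a.
(* The first joint action ends the hop and the later ones extend the trace of [K], so the tester
   state depends on whether the trace is still as long as [u]. *)
pose W u' : ext L hop := Exit (if size u' == size u then Go (r ++ v) u [::] else Extend (r ++ v) u').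
have W0 : W u = Exit (Go (r ++ v) u [::]) by rewrite /W eqxx.
have W1 w2 y : W (u ++ rcons w2 y) = Exit (Extend (r ++ v) (u ++ rcons w2 y)).
  by rewrite /W size_cat size_rcons; case: eqP => // /eqP; rewrite -{2}[size u]addn0 eqn_add2l.
have := @comp_walk _ (act_prefix d K) _ (ext_tester d hop_exit hop_tester)
  (Follow (init L) [::]) (alphabet L) W (Some k) u w (Some k') (prefix_weak d kw).
have [w1 [y wE]] : exists w1 y, w = rcons w1 y.
  by case: (w) w0 => [//|y w1] _; exists (belast y w1), (last y w1); rewrite -lastI.
subst w; rewrite W0 W1; apply=> w2 x w3 _.
rewrite W1; case/lastP: w2 => [|w2 z]; first by rewrite cats0 W0; split=> //; exists x; rewrite cats1.
by rewrite W1; split=> //; exists x; rewrite rcons_cat.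
Qed.

(** Rounds alternate: hop from the prefix of [xi] of length [n k] to the next one, then let [K]
    advance along [zeta] to length [m k.+1]. The lengths [m k] are chosen inside [N] for long hops;
    otherwise any growth suffices. *)
Lemma hop_Inf_sup K xi (n : nat -> nat) : Inf K zeta ->
  (forall k, n k < n k.+1) -> (forall k, Div L (prefix_of xi (n k))) ->
  (~ long -> forall k, n k.+1 = (n k).+1) ->
  (long -> forall m, exists j, m <= j /\ N (prefix_of zeta j)) ->
  Inf (C K) xi.
Proof.
move=> /InfP/weak_inf_blocks[q [q0 qP]] nS nD short far.
have [m [mS mN]] : exists m : nat -> nat, (forall k, m k < m k.+1) /\
    (long -> forall k, N (prefix_of zeta (m k))).
  have [lo|nlo] := EM long; last by exists id.
  by have [m [mS mN]] := infinitely_often_seq (far lo); exists m.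
have qweak a b : a <= b -> weak (q a) (prefix_of (fun j => zeta (a + j)) (b - a)) (q b).
  move=> ab; rewrite -{1}(addn0 a) -{2}(subnKC ab).
  have := @blocks_weak _ K (fun j => q (a + j)) (fun j => zeta (a + j)) (b - a); apply.
  by move=> j; rewrite addnS; exact: qP.
apply: (@Inf_words _ (C K) (fun k => (Some (q (m k)),
    Exit (Extend (prefix_of xi (n k)) (prefix_of zeta (m k))))) n).
- apply: (@ext_exit _ _ d _ hop_exit hop_tester K _ (prefix_of zeta (m 0)) (q (m 0)) _ (nD 0)) => //.
  by have := qweak 0 (m 0) (leq0n _); rewrite subn0 q0.
- by move=> k; exact: ltnW.
- by move=> M; exists M; exact: increasing_ge.
move=> k; rewrite (prefix_of_split xi (ltnW (nS k))) (prefix_of_split zeta (ltnW (mS k))).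
have size_seg (T : Type) (z : nat -> T) a b : a < b ->
    prefix_of (fun j => z (a + j)) (b - a) <> [::].
  move=> ab /(congr1 size)/eqP; rewrite size_prefix_of subn_eq0 leqNgt.
  by rewrite ab.
apply: hop_round; last exact: qweak (ltnW (mS k)).
- split.
  + exact: size_seg.
  + by rewrite -(prefix_of_split xi (ltnW (nS k))); exact: nD.
  + by rewrite size_prefix_of.
  + by move=> lo; exact: mN.
  + by move=> /short ->; rewrite size_prefix_of subSnn.
- have /Div_Tr/Tr_word := nD k.+1.
  by rewrite (prefix_of_split xi (ltnW (nS k))) => /word_cat[].
exact: size_seg.
Qed.

End Hop.

(* [long = False]: one-letter hops, for infinite traces with cofinitely many
   divergent prefixes; [long = True]: arbitrary hops, taken while [K] does not
   diverge, for infinite traces with infinitely many divergent prefixes. *)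
Lemma cong_infinite_traces K K' zeta (long : Prop) : cong K K' -> alphabet K = alphabet K' ->
  Inf K zeta -> ~ Inf K' zeta ->
  (long -> forall m, exists j, [/\ m <= j, ~ Div K (prefix_of zeta j) &
     ~ Div K' (prefix_of zeta j)]) ->
  forall L, (forall r A, extT L r -> Tr L r -> ~ Div L r -> A `<=` alphabet L -> Sf L (r, A)) ->
  exists L1, [/\ cong L L1, alphabet L1 = alphabet L, Div L1 = Div L, nF L1 = nF L &
    Inf L1 = Inf L `|` [set xi |
      (long /\ forall m, exists j, m <= j /\ Div L (prefix_of xi j)) \/
      exists n, forall j, n <= j -> Div L (prefix_of xi j)]].
Proof.
move=> KK' AE IK nIK' far L sat; have [d _] := some_action.
(* Divergence is excluded for both: the extension by [K'] must agree with [L], and the one by [K]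
   must add no divergences. *)
pose N u := ~ Div K u /\ ~ Div K' u.
pose C := extension L d hop_exit (hop_tester L zeta long N).
have NK u : N u -> ~ Div K u by case.
have NK' u : N u -> ~ Div K' u by case.
have IE' : Inf (C K') = Inf L.
  apply/predeqP => xi; split; last exact: ext_Inf_base.
  by move=> /(hop_Inf_sub)[//|[/nIK']].
exists (C K); split=> //.
- apply: (extension_cong_from AE KK'); split=> //.
    by apply: hop_Div => _; exact: NK'.
  by apply: hop_nF => // _; exact: NK'.
- by apply: hop_Div => _; exact: NK.
- by apply: hop_nF => // _; exact: NK.
apply/predeqP => xi; split.
  move=> /hop_Inf_sub[|[_ inf cofin]]; [by left|right].
  by have [lo|/cofin] := EM long; [left|right].
move=> [IL|h]; first exact: ext_Inf_base.
have [lo|nlo] := EM long.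
  have /infinitely_often_seq[n [nS nD]] : forall m, exists j, m <= j /\ Div L (prefix_of xi j).
    case: h => [[_]//|[n nD]] m; exists (maxn m n); split; first exact: leq_maxl.
    by apply: nD; exact: leq_maxr.
  apply: (@hop_Inf_sup L d zeta long N K xi n IK nS nD) => // _ m.
  by have [j [mj D1 D2]] := far lo m; exists j.
case: h => [[]//|[n nD]].
apply: (@hop_Inf_sup L d zeta long N K xi (addn n) IK) => // [k|k|_ k]; rewrite ?addnS //.
by apply: nD; exact: leq_addr.
Qed.

End Saturation.

(** * Properties preserved by the congruence *)

Section Probe.
Variables (Act : Type) (K : LTS Act) (sigma : seq Act) (c : Act).

(* After [sigma] has been performed silently, [c] can be shown; afterwards both
   divergence and [c c c ...] are possible. *)
Definition probe_tester : tester Act (option (seq Act)) := fun t y t' =>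
  match t, t' with
  | Some u, Some u' => exists x, y = Some (inr x) /\ u' = rcons u x
  | Some u, None => y = Some (inl c) /\ u = sigma
  | None, None => y = None \/ y = Some (inl c)
  | None, Some _ => False
  end.

Local Notation C := (tested K probe_tester (Some [::]) [set c]).

Lemma probe_sound : Tr C [:: c] -> Tr K sigma.
Proof.
move=> /TrP[[k t]].
pose J (v : seq Act) (s : state C) := match s.2 with
  | Some u => v = [::] /\ weak (init K) u s.1 | None => Tr K sigma end.
have Jnext v s y s' : J v s -> trans s y s' -> J (v ++ lbl y) s'.
  case: s s' => k1 t1 [k2 t2]; rewrite /J /=.
  case: t1 => [u [-> uk]|TK]; last first.
    by case: t2 => [u2|//]; case: y => [a|] /=; [move=> [_ _ []]|move=> [[_ []]|[_ ]|[b [_ []]]]].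
  case: y => [a|] /=.
    move=> [_ -> h]; case: t2 h => [u2 [? []]//|[_ <-]]; by apply/TrP; exists k1.
  move=> [[-> h]|[k12 ->]|[b [k12 h]]].
  - by case: t2 h => [u2 [? []]|[]].
  - by split=> //; exact: weak_tau_r uk k12.
  case: t2 h => [u2 [x [[<-] ->]]|[] //]; split=> //; rewrite -cats1; exact: weak_rcons uk k12.
move=> ct; have /= := @weak_invariant _ C J Jnext [::] (init C) [:: c] (k, t) _ ct.
rewrite {1}/J /= => /(_ (conj erefl (weak0 _))).
by rewrite /J /=; case: t {ct} => [u []|].
Qed.

Lemma probe_reach : Tr K sigma -> exists k, weak (init C) [:: c] (k, None).
Proof.
move=> /TrP[k sk]; exists k.
have walk := @comp_free_walk _ K _ probe_tester (Some [::]) [set c] Some (init K) [::] sigma k.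
apply: (@weak_cat _ C _ [::] (k, Some sigma) [:: c]).
  by apply: walk => // w x; exists x.
by apply: weak_act.
Qed.

Lemma probe_Div : Div C [:: c] <-> Tr K sigma.
Proof.
split=> [/Div_Tr/probe_sound//|/probe_reach[k ck]].
apply/DivP; exists (k, None); split=> //.
apply: (@diverges_coind _ C (fun s => s = (k, None))) => // _ ->; exists (k, None).
by split=> //; apply: comp_trans_tau; left.
Qed.

Lemma probe_Inf : Inf C (fun _ => c) <-> Tr K sigma.
Proof.
split=> [/(Inf_Tr 1)/probe_sound//|/probe_reach[k ck]].
apply: (@Inf_cat _ C _ 1 (k, None)) => //.
apply: (@weak_inf_coind _ C (fun _ s => s = (k, None))) => // _ _ ->; exists (k, None).
split=> //; exists (k, None); split; first exact: weak0.
by split=> //; right.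
Qed.

End Probe.

(** * Detecting an infinite trace through a divergence *)

Section Tail.
Variables (Act : Type) (K : LTS Act) (xi : nat -> Act) (n : nat) (c : Act).

(* Performs [xi] silently, showing [c] after its first [n] letters. *)
Definition tail_tester : tester Act (nat * bool) := fun t y t' =>
  (t' = (t.1.+1, t.2) /\ y = Some (inr (xi t.1)) /\ (t.2 \/ t.1 < n)) \/
  [/\ t = (n, false), t' = (n, true) & y = Some (inl c)].

Local Notation C := (tested K tail_tester (0, false) [set c]).

Lemma tail_inv v k i b : weak (init C) v (k, (i, b)) ->
  [/\ weak (init K) (prefix_of xi i) k, b = (0 < size v) & if b then n <= i else i <= n].
Proof.
pose J (v : seq Act) (s : state C) := [/\ weak (init K) (prefix_of xi s.2.1) s.1,
  s.2.2 = (0 < size v) & if s.2.2 then n <= s.2.1 else s.2.1 <= n].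
have Jnext u s y s' : J u s -> trans s y s' -> J (u ++ lbl y) s'.
  case: s s' => k1 [i1 b1] [k2 [i2 b2]]; rewrite /J /= => -[ik b1E ib].
  case: y => [a|] /=.
    move=> [_ -> [[_ [//]]|[[i1E b1E'] [-> ->] _]]].
    by rewrite size_cat addn1 leqnn; split=> //; rewrite -i1E.
  rewrite cats0 => -[[-> [[_ [//]]|[_ _ //]]]|[k12 [-> ->]]|[x [k12 [[[-> ->] [[xE] bi]]|[_ _ //]]]]].
    by split=> //; exact: weak_tau_r ik k12.
  split=> //; first by rewrite prefix_ofS -cats1 -xE; exact: weak_rcons ik k12.
  by case: b1 bi ib {b1E} => // [_ /leqW|[]].
move=> vk; have /= := @weak_invariant _ C J Jnext [::] (init C) v (k, (i, b)) _ vk.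
by apply; split=> //; exact: weak0.
Qed.

(** If [K] diverges after no prefix of length at least [n], every silent run of [K] on the path
    ends, so the divergence contains infinitely many joint moves, and these spell out [xi]. *)
Lemma tail_sound : Div C [:: c] -> Inf K xi \/ exists i, n <= i /\ Div K (prefix_of xi i).
Proof.
move=> /DivP[[k [i b]] [/tail_inv[/= ik -> ni] dc]].
have [[j [nj Dj]]|nD] := EM (exists i, n <= i /\ Div K (prefix_of xi i)); [by right; exists j|left].
have nDi j : n <= j -> ~ Div K (prefix_of xi j) by move=> nj Dj; apply: nD; exists j.
apply: (Inf_cat ik).
pose G m k := weak (init K) (prefix_of xi (i + m)) k /\ @diverges _ C (k, (i + m, true)).
apply: (@weak_inf_coind _ _ G) => [m k1 [ik1 dc1]|]; last by rewrite /G addn0.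
have : tau_wf k1.
  by apply/tau_wfP => dk; apply: (nDi (i + m)); [exact: leq_trans ni (leq_addr _ _)|apply/DivP; exists k1].
move=> wk; elim: wk ik1 dc1 => {}k1 _ IH ik1 /diverges_inv[[k2 [j b']] [[]]] /=.
- by move=> [_ [[_ []]|[]]].
- move=> [kk2 [-> ->]] dc2.
  have [t [[r [k2r rt]] Gt]] := IH _ kk2 (weak_tau_r ik1 kk2) dc2.
  by exists t; split=> //; exists r; split=> //; exact: weak_tau_l kk2 k2r.
move=> [x [kx [[[-> ->] [[xE] _]]|[]//]]] dc2; subst x.
exists k2; split; first by exists k1; split=> //; exact: weak0.
by split; rewrite addnS // prefix_ofS -cats1; exact: weak_rcons ik1 kx.
Qed.

Lemma tail_reach i k : n <= i -> weak (init K) (prefix_of xi i) k ->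
  weak (init C) [:: c] (k, (i, true)).
Proof.
move=> ni; rewrite (prefix_of_split xi ni) => /weak_catP[k0 [nk0 k0k]].
have walk k1 m (b : bool) l k2 : (forall j, j < l -> b \/ m + j < n) ->
    weak k1 (prefix_of (fun j => xi (m + j)) l) k2 ->
    @weak _ C (k1, (m, b)) [::] (k2, (m + l, b)).
  move=> ok kw; have := @comp_walk _ K _ tail_tester (0, false) [set c]
    (fun u => (m + size u, b)) k1 [::] _ k2 kw.
  rewrite /= size_prefix_of addn0; apply=> u x u' uE; left => /=.
  have ul : size u < l.
    by rewrite -(size_prefix_of (fun j => xi (m + j)) l) uE size_cat /= -addSnnS leq_addr.
  rewrite size_rcons addnS; split=> //; split; last exact: ok.
  have := congr1 (nth x ^~ (size u)) uE; rewrite nth_mkseq // nth_cat ltnn subnn /=.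
  by move=> ->.
apply: (@weak_cat _ C _ [::] (k0, (n, false)) [:: c]).
  by apply: (walk _ 0 false n) => //; right.
apply: (@weak_cat _ C _ [:: c] (k0, (n, true)) [::]); first by apply: weak_act; split=> //; right.
by have := walk _ _ true _ _ (fun _ _ => or_introl isT) k0k; rewrite subnKC.
Qed.

Lemma tail_complete : Inf K xi \/ (exists i, n <= i /\ Div K (prefix_of xi i)) -> Div C [:: c].
Proof.
move=> [/InfP/weak_inf_blocks[q [q0 qP]]|[i [ni /DivP[k [ik dk]]]]]; apply/DivP.
  exists (q n, (n, true)); split; first by apply: tail_reach => //; rewrite -q0; exact: blocks_weak.
  apply: (@diverges_chain _ C (fun s => exists i, s = (q i, (i, true)))); last by exists n.
  move=> _ [i ->]; have [r [ir rq]] := qP i.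
  exists (r, (i, true)), (q i.+1, (i.+1, true)); split; last by exists i.+1.
    exact: comp_hidden.
  by apply: (@comp_trans_sync _ K _ _ _ _ _ _ (xi i)) => //; left; split=> //; split=> //; left.
exists (k, (i, true)); split; first exact: tail_reach.
apply: (@diverges_coind _ C (fun s => exists k', s = (k', (i, true)) /\ diverges k')); last by exists k.
move=> _ [k1 [-> /diverges_inv[k2 [k12 dk2]]]]; exists (k2, (i, true)); split; last by exists k2.
exact: comp_trans_hidden.
Qed.

End Tail.

Section Silent.
Variables (Act : Type) (K : LTS Act) (xi : nat -> Act) (c : Act).

(** With [n = 0] no joint move precedes [c], so [K] alone must diverge; this serves to show that
    [[:: c]] is a minimal divergence. *)
Lemma tail_silent : Div (tested K (tail_tester xi 0 c) (0, false) [set c]) [::] -> Div K [::].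
Proof.
move=> /DivP[[k [i b]] [h dc]]; have [/= ik bE i0] := tail_inv h.
rewrite bE /= leqn0 in i0; rewrite bE (eqP i0) in ik dc.
apply/DivP; exists k; split; first exact: ik.
apply: contrapT => /tau_wfP wk; move: dc; apply/tau_wfP; elim: wk {h ik} => {}k _ IH.
apply: Acc_intro => -[k2 t] /= [[_ h]|[kk2 ->]|[b' [_ h]]].
- by move: h => [[_ []]|[]].
- exact: IH.
by move: h => [[_ [_ []]]|[]].
Qed.

End Silent.

(** * Alphabets and traces that preserved failures and divergences reveal *)

Section Preservation.
Variables (Act : Type) (cong : LTS Act -> LTS Act -> Prop).
Hypotheses (Act_infinite : infinite_set [set: Act]) (cong_congr : congruence cong).

Definition one_shot_trans (a : Act) (s : bool) (x : option Act) (s' : bool) : Prop :=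
  [/\ s = false, x = Some a & s' = true].

Lemma one_shot_alphabet a s b s' : one_shot_trans a s (Some b) s' -> [set a] b.
Proof. by case=> _ []. Qed.

Definition one_shot a : LTS Act := MkLTS false (@one_shot_alphabet a).

(* Before [b] is performed, [a] is possible in [b.L || one_shot a] exactly when
   [L] does not have [a] in its alphabet. *)
Lemma guarded_silent L a b u x : a <> b ->
  weak (init (par (act_prefix b L) (one_shot a))) u x -> (forall z, List.In z u -> z = a) ->
  x.1 = None /\ (alphabet L a -> u = [::]).
Proof.
move=> ab h ua.
pose J v (s : state (par (act_prefix b L) (one_shot a))) := (forall z, List.In z v -> z = a) ->
  s.1 = None /\ (alphabet L a -> v = [::]).
have Jnext v s y s' : J v s -> trans s y s' -> J (v ++ lbl y) s'.
  move=> Jvs tr va.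
  have [s1 vE] : s.1 = None /\ (alphabet L a -> v = [::]).
    by apply: Jvs => z zv; apply: va; apply: List.in_or_app; left.
  have yab : y <> Some b.
    move=> yE; apply: ab; apply/esym; apply: va; rewrite yE.
    by apply: List.in_or_app; right; left.
  case: s s' s1 tr {Jvs} => [s1 s2] [s1' s2'] /= -> [[_ /= h1 _]|[_ /= h1 _]|[ns /= -> [_ yE _]]].
  - by have [/yab] := @prefix_trans0 _ L b y s1' h1.
  - by have [/yab] := @prefix_trans0 _ L b y s1' h1.
  split=> // La; case: ns; rewrite yE; split=> //=; by left.
have := @weak_invariant _ _ J Jnext [::] _ u x _ h; apply=> //.
Qed.

Lemma guarded_stable L a b (x : state (par (act_prefix b L) (one_shot a))) :
  x.1 = None -> stable x.
Proof.
case: x => x1 x2 /= -> [y1 y2] [[]//|[_ /= h _]|[_ _ []//]].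
by have [] := @prefix_trans0 _ L b None y1 h.
Qed.

(** If [a] lies in only one of the alphabets, the failure [([:: a], set0)] distinguishes the guarded
    compositions; it counts in [anF] because nothing diverges before [b]. *)
Lemma preserves_anF_alphabet L L' : preserves cong (@anF Act) -> cong L L' ->
  alphabet L = alphabet L'.
Proof.
move=> pF.
suff sub M M' : cong M M' -> alphabet M `<=` alphabet M'.
  by move=> LL'; apply/seteqP; split; apply: sub => //; exact: (cong_sym cong_congr).
move=> MM' a Ma; apply: contrapT => nM'a.
have [f0 [f1 [_ _ f01]]] := disjoint_injections Act_infinite.
(* As [f0] and [f1] have disjoint ranges, [a] differs from [f0 a] or from [f1 a]. *)
have [b ab] : exists b, a <> b.
  by have [e|] := EM (a = f0 a); [exists (f1 a); rewrite {1}e|exists (f0 a)].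
have /pF FE : cong (par (act_prefix b M) (one_shot a)) (par (act_prefix b M') (one_shot a)).
  by apply: (congruence_parl cong_congr); exact: (congruence_prefix cong_congr).
have only_a : forall z, List.In z [:: a] -> z = a by move=> z [|[]].
suff : anF (par (act_prefix b M') (one_shot a)) ([:: a], set0).
  rewrite -FE => -[/SfP[_ [x [ax _ _]]] _].
  by have [_ /(_ Ma)] := guarded_silent ab ax only_a.
split.
  apply/SfP; split=> //; exists (None, true); split=> //; last exact: guarded_stable.
  apply: weak_act; apply: Or33; split=> //; move=> [[/nM'a//|/= ba] _].
  exact: ab.
move=> [_ [i [_ [/DivP[x [ix dx]] _]]]].
have ia z : List.In z (take i [:: a]) -> z = a.
  by case: i {ix} => [|i] //= [].
have [x1 _] := guarded_silent ab ix ia.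
exact: stable_not_diverges (guarded_stable x1) dx.
Qed.

Lemma cong_tested L L' T (tt : tester Act T) t0 S : preserves cong (@anF Act) -> cong L L' ->
  cong (tested L tt t0 S) (tested L' tt t0 S).
Proof.
move=> pF LL'; apply: comp_cong => //; exact: preserves_anF_alphabet.
Qed.

Lemma preserves_Tr_of_Div : preserves cong (@anF Act) -> preserves cong (@Div Act) ->
  preserves cong (@Tr Act).
Proof.
move=> pF pD L L' LL'; have [c _] := some_action Act_infinite.
apply/predeqP => u; rewrite -(probe_Div L u c) -(probe_Div L' u c).
by rewrite (pD _ _ (cong_tested _ _ _ pF LL')).
Qed.

Lemma preserves_Tr_of_Inf : preserves cong (@anF Act) -> preserves cong (@Inf Act) ->
  preserves cong (@Tr Act).
Proof.
move=> pF pI L L' LL'; have [c _] := some_action Act_infinite.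
apply/predeqP => u; rewrite -(probe_Inf L u c) -(probe_Inf L' u c).
by rewrite (pI _ _ (cong_tested _ _ _ pF LL')).
Qed.

(** The tail test starts where the divergent prefixes of [xi] end. They end at the same place for
    [L'], so a divergence after [c] can only come from the infinite trace itself. *)
Lemma preserves_eanI_of_Div : preserves cong (@anF Act) -> preserves cong (@Div Act) ->
  preserves cong (@eanI Act).
Proof.
move=> pF pD; have [c _] := some_action Act_infinite.
suff sub L L' : cong L L' -> eanI L `<=` eanI L'.
  by move=> L L' LL'; apply/seteqP; split; apply: sub => //; exact: (cong_sym cong_congr).
move=> LL' xi [IL [n nD]]; have DE := pD _ _ LL'.
have nD' i : n <= i -> ~ Div L' (prefix_of xi i) by rewrite -DE; exact: nD.
have D' : Div (tested L' (tail_tester xi n c) (0, false) [set c]) [:: c].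
  by rewrite -(pD _ _ (cong_tested _ _ _ pF LL')); apply: tail_complete; left.
have [IL'|[i [/nD']]//] := tail_sound D'.
by split=> //; exists n.
Qed.

(** No prefix of [xi] is divergent in [L] or [L'], so the tail test with [n = 0] shows the infinite
    trace as a minimal divergence. *)
Lemma preserves_anI_of_minD : preserves cong (@anF Act) -> preserves cong (@minD Act) ->
  preserves cong (@anI Act).
Proof.
move=> pF pM; have [c _] := some_action Act_infinite.
suff sub L L' : cong L L' -> anI L `<=` anI L'.
  by move=> L L' LL'; apply/seteqP; split; apply: sub => //; exact: (cong_sym cong_congr).
move=> LL' xi [IL nE]; have ME := pM _ _ LL'; have AE := preserves_anF_alphabet pF LL'.
have nE' : ~ extI L' xi by rewrite /extI /= /omega_word -AE -ME; exact: nE.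
have nD i : ~ Div L (prefix_of xi i).
  by move=> /extI_Div h; apply/nE/h; case: IL.
have nD' i : ~ Div L' (prefix_of xi i).
  by move=> /extI_Div h; apply/nE'/h; rewrite /omega_word -AE; case: IL.
have [D' _] : minD (tested L' (tail_tester xi 0 c) (0, false) [set c]) [:: c].
  rewrite -(pM _ _ (cong_tested _ _ _ pF LL')); split; first by apply: tail_complete; left.
  by move=> [|//] _ /= D0; apply: (nD 0); exact: tail_silent D0.
by have [IL'|[i [_ /nD']]//] := tail_sound D'; split.
Qed.

End Preservation.

(** * The induced equivalences *)

Section Cases.
Variables (Act : Type) (cong : LTS Act -> LTS Act -> Prop).
Hypotheses (Act_infinite : infinite_set [set: Act]) (cong_congr : congruence cong)
  (cong_cffd : forall L L', cffd_equiv L L' -> cong L L') (cong_VB : cong V B)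
  (pres_anF : preserves cong (@anF Act)).
Implicit Types L K : LTS Act.

Let symm L L' (h : cong L L') : cong L' L := cong_sym cong_congr h.
Let AE L L' (h : cong L L') : alphabet L = alphabet L' :=
  preserves_anF_alphabet Act_infinite cong_congr pres_anF h.

Lemma not_preserves_witness T (X : LTS Act -> set T) : ~ preserves cong X ->
  exists K K' x, [/\ cong K K', X K x & ~ X K' x].
Proof.
move=> nX; apply: contrapT => h; apply: nX => L L' LL'; apply/predeqP => x.
by split=> xX; apply: contrapT => nxX; apply: h;
  [exists L, L', x|exists L', L, x]; split=> //; exact: symm.
Qed.

Lemma cong_saturations L L' L1 L1' : cong L L1 -> cong L' L1' ->
  alphabet L1 = alphabet L1' -> nF L1 = nF L1' -> Div L1 = Div L1' -> Inf L1 = Inf L1' ->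
  cong L L'.
Proof.
move=> LL1 LL1' A1 F1 D1 I1; apply: (cong_trans cong_congr LL1).
apply: (cong_trans cong_congr _ (symm LL1')).
exact: cong_nF.
Qed.

Lemma extT_eq L L' : alphabet L = alphabet L' -> minD L = minD L' -> extT L = extT L'.
Proof. by move=> A_eq M_eq; rewrite /extT /word A_eq M_eq. Qed.

Lemma extI_eq L L' : alphabet L = alphabet L' -> minD L = minD L' -> extI L = extI L'.
Proof. by move=> A_eq M_eq; rewrite /extI /omega_word A_eq M_eq. Qed.

Lemma minD_eq L L' : Div L = Div L' -> minD L = minD L'.
Proof. by move=> D_eq; rewrite /minD D_eq. Qed.

Lemma saturate_failures : preserves cong (@Div Act) -> ~ preserves cong (@snF Act) ->
  forall L, exists L1,
  [/\ cong L L1, alphabet L1 = alphabet L, Div L1 = Div L, Inf L1 = Inf L &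
    nF L1 = [set f | [/\ ~ Div L f.1, f.2 `<=` alphabet L &
                         Sf L f \/ extT L f.1 /\ Tr L f.1]]].
Proof.
move=> pD /not_preserves_witness[K [K' [[u A] [KK' FK nFK']]]].
have DE := pD _ _ KK'; have [[_ nDK] nDKa] := FK.
apply: (cong_failures Act_infinite cong_congr cong_cffd cong_VB KK' (AE KK') FK).
- move=> FK'; apply: nFK'; split; first by split=> //; rewrite -DE.
  by rewrite -DE.
- by rewrite -DE.
by rewrite -DE.
Qed.

Definition failure_saturated L := forall r A, extT L r -> Tr L r -> ~ Div L r ->
  A `<=` alphabet L -> Sf L (r, A).

Lemma saturate_failures_saturated L L1 : alphabet L1 = alphabet L -> Div L1 = Div L ->
  nF L1 = [set f | [/\ ~ Div L f.1, f.2 `<=` alphabet L &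
                         Sf L f \/ extT L f.1 /\ Tr L f.1]] ->
  failure_saturated L1.
Proof.
move=> A_eq D_eq F_eq r A; rewrite (extT_eq A_eq (minD_eq D_eq)) => Er TrL1 nD AL.
suff : nF L1 (r, A) by case.
rewrite F_eq -D_eq -A_eq; split=> //; right; split=> //.
have [//|] := (Tr_nF L1 r).1 TrL1.
by rewrite F_eq => -[_ _ [/Sf_Tr|[]]].
Qed.

(** Afterwards no non-divergent trace of [L1] lies in [extT L1], so saturation of failures is
    vacuous. *)
Lemma saturate_divergences : ~ preserves cong (@Div Act) -> forall L, exists L1,
  [/\ cong L L1, alphabet L1 = alphabet L, Div L1 = extT L `&` Tr L, nF L1 = anF L &
      Inf L1 = Inf L] /\ failure_saturated L1.
Proof.
move=> /not_preserves_witness[K [K' [u [KK' DK nDK']]]] L.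
have [L1 [LL1 A_eq D_eq F_eq I_eq]] :=
  cong_divergences Act_infinite cong_congr cong_cffd cong_VB KK' (AE KK') DK nDK' L.
exists L1; split=> // r A [Lr [i [_ [+ _]]]] TrL1 nD _; rewrite D_eq => -[Ei _].
have [//|] := (Tr_nF L1 r).1 TrL1; rewrite F_eq => -[_ []].
rewrite /= -(cat_take_drop i r); apply: extT_cat => //.
by rewrite cat_take_drop /word -A_eq.
Qed.

Lemma saturate_Inf : ~ preserves cong (@Inf Act) -> forall L, failure_saturated L ->
  exists L1, [/\ cong L L1, alphabet L1 = alphabet L, Div L1 = Div L, nF L1 = nF L &
    Inf L1 = Inf L `|` [set xi | exists n, forall j, n <= j -> Div L (prefix_of xi j)]].
Proof.
move=> /not_preserves_witness[K [K' [z [KK' IK nIK']]]] L sat.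
have [L1 [LL1 A_eq D_eq F_eq I_eq]] := cong_infinite_traces Act_infinite cong_congr
  cong_cffd cong_VB (long := False) KK' (AE KK') IK nIK' (fun f => match f with end) sat.
exists L1; split=> //; rewrite I_eq; congr (_ `|` _); apply/predeqP => xi.
by split=> [[[]//|//]|h]; right.
Qed.

(** Since [Div] is preserved, the infinitely many non-divergent prefixes of the witness are common
    to [K] and [K']; they are the resting places needed for long hops. *)
Lemma saturate_aenI : preserves cong (@Div Act) -> ~ preserves cong (@aenI Act) ->
  forall L, failure_saturated L ->
  exists L1, [/\ cong L L1, alphabet L1 = alphabet L, Div L1 = Div L, nF L1 = nF L &
    Inf L1 = Inf L `|` [set xi | forall n, exists j, n <= j /\ Div L (prefix_of xi j)]].
Proof.
move=> pD /not_preserves_witness[K [K' [z [KK' [IK often] nIK']]]] L sat.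
have DE := pD _ _ KK'.
have nIK : ~ Inf K' z by move=> IK'; apply: nIK'; split=> //; rewrite -DE.
have far : True -> forall m, exists j, [/\ m <= j, ~ Div K (prefix_of z j) &
     ~ Div K' (prefix_of z j)].
  by move=> _ m; have [j [mj nD]] := often m; exists j; rewrite -DE.
have [L1 [LL1 A_eq D_eq F_eq I_eq]] := cong_infinite_traces Act_infinite cong_congr
  cong_cffd cong_VB KK' (AE KK') IK nIK far sat.
exists L1; split=> //; rewrite I_eq; congr (_ `|` _); apply/predeqP => xi.
split=> [[[]//|[n nD]] m|h]; last by left.
by exists (maxn m n); split; [exact: leq_maxl|apply: nD; exact: leq_maxr].
Qed.

Lemma setU_eq_mod T (A A' B : set T) : A `\` B = A' `\` B -> A `|` B = A' `|` B.
Proof.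
move=> e; have H (X : set T) : X `|` B = (X `\` B) `|` B.
  apply/predeqP => x; split=> [[Xx|]|[[]|]]; [|by right|by left|by right].
  by have [Bx|nBx] := EM (B x); [right|left].
by rewrite H e -H.
Qed.

(** After saturation [Inf] has absorbed [extI], so only [anI] of the original infinite traces
    matters. *)
Lemma case_chaos : preserves cong (@minD Act) -> ~ preserves cong (@Tr Act) ->
  forall L L', cong L L' <->
    [/\ alphabet L = alphabet L', anF L = anF L', minD L = minD L' & anI L = anI L'].
Proof.
move=> pM /not_preserves_witness[K [K' [u [KK' TK nTK']]]] L L'; split.
  move=> LL'; split; [exact: AE|exact: pres_anF|exact: pM|].
  exact: (preserves_anI_of_minD Act_infinite cong_congr).
move=> [A_eq F_eq M_eq I_eq].
have sat := cong_chaos Act_infinite cong_congr cong_cffd cong_VB KK' (AE KK') TK nTK'.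
have [L1 [LL1 A1 D1 F1 I1]] := sat L; have [L2 [LL2 A2 D2 F2 I2]] := sat L'.
apply: (cong_saturations LL1 LL2); rewrite ?A1 ?A2 ?F1 ?F2 ?D1 ?D2 ?I1 ?I2 //.
  exact: extT_eq.
by rewrite -(extI_eq A_eq M_eq); apply: setU_eq_mod; rewrite {2}(extI_eq A_eq M_eq).
Qed.

Lemma case_Tr_anI : preserves cong (@Tr Act) -> preserves cong (@minD Act) ->
  ~ preserves cong (@Div Act) -> ~ preserves cong (@Inf Act) ->
  forall L L', cong L L' <->
    [/\ alphabet L = alphabet L', Tr L = Tr L', anF L = anF L', minD L = minD L'
      & anI L = anI L'].
Proof.
move=> pT pM nD nI L L'; split.
  move=> LL'; split; [exact: AE|exact: pT|exact: pres_anF|exact: pM|].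
  exact: (preserves_anI_of_minD Act_infinite cong_congr).
move=> [A_eq T_eq F_eq M_eq I_eq].
have sat M : exists M1, [/\ cong M M1, alphabet M1 = alphabet M, Div M1 = extT M `&` Tr M,
    nF M1 = anF M & Inf M1 = Inf M `|`
      [set xi | exists n, forall j, n <= j -> (extT M `&` Tr M) (prefix_of xi j)]].
  have [M1 [[MM1 A1 D1 F1 I1] /(saturate_Inf nI)[M2 [MM2 A2 D2 F2 I2]]]] :=
    saturate_divergences nD M.
  exists M2; split; rewrite ?A2 ?D2 ?F2 ?I2 ?D1 ?I1 //.
  exact: (cong_trans cong_congr MM1).
have [L1 [LL1 A1 D1 F1 I1]] := sat L; have [L2 [LL2 A2 D2 F2 I2]] := sat L'.
apply: (cong_saturations LL1 LL2); rewrite ?A1 ?A2 ?F1 ?F2 ?D1 ?D2 ?I1 ?I2 //.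
  by rewrite (extT_eq A_eq M_eq) T_eq.
(* From its minimal divergent prefix on, an infinite trace in [extI M] has all prefixes in [extT M]
   and in [Tr M]; the added set thus absorbs the part of [Inf M] outside [anI M]. *)
have Inf_split M : Inf M `|` [set xi | exists n, forall j, n <= j ->
      (extT M `&` Tr M) (prefix_of xi j)] =
    anI M `|` [set xi | exists n, forall j, n <= j -> (extT M `&` Tr M) (prefix_of xi j)].
  apply/predeqP => xi; split=> [[IM|]|[[IM _]|]]; [|by right|by left|by right].
  have [[LM [i mi]]|nE] := EM (extI M xi); last by left.
  right; exists i => j ij; split; last exact: Inf_Tr.
  split; first by move/prefix_of_word: LM.
  by exists i; rewrite size_prefix_of take_prefix_of.
by rewrite !Inf_split I_eq (extT_eq A_eq M_eq) T_eq.
Qed.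

Lemma case_minD_Inf : preserves cong (@minD Act) -> preserves cong (@Inf Act) ->
  ~ preserves cong (@Div Act) ->
  forall L L', cong L L' <->
    [/\ alphabet L = alphabet L', Tr L = Tr L', anF L = anF L', minD L = minD L'
      & Inf L = Inf L'].
Proof.
move=> pM pI nD L L'; split.
  move=> LL'; split; [exact: AE| |exact: pres_anF|exact: pM|exact: pI].
  exact: (preserves_Tr_of_Inf Act_infinite cong_congr).
move=> [A_eq T_eq F_eq M_eq I_eq].
have [L1 [[LL1 A1 D1 F1 I1] _]] := saturate_divergences nD L.
have [L2 [[LL2 A2 D2 F2 I2] _]] := saturate_divergences nD L'.
apply: (cong_saturations LL1 LL2); rewrite ?A1 ?A2 ?F1 ?F2 ?D1 ?D2 ?I1 ?I2 //.
by rewrite (extT_eq A_eq M_eq) T_eq.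
Qed.

(** Failures at traces in [extT] are absorbed by the added ones, so [anF] carries all that is
    left. *)
Lemma saturated_failures_eq L L' : alphabet L = alphabet L' -> Tr L = Tr L' ->
  anF L = anF L' -> Div L = Div L' ->
  [set f | [/\ ~ Div L f.1, f.2 `<=` alphabet L & Sf L f \/ extT L f.1 /\ Tr L f.1]] =
  [set f | [/\ ~ Div L' f.1, f.2 `<=` alphabet L' & Sf L' f \/ extT L' f.1 /\ Tr L' f.1]].
Proof.
have split_anF M : [set f | [/\ ~ Div M f.1, f.2 `<=` alphabet M &
      Sf M f \/ extT M f.1 /\ Tr M f.1]] =
    [set f | [/\ ~ Div M f.1, f.2 `<=` alphabet M & anF M f \/ extT M f.1 /\ Tr M f.1]].
  apply/predeqP => f; split=> -[nD AM h]; split=> //; case: h => [SM|]; [|by right| |by right].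
    by have [E|nE] := EM (extT M f.1); [right; split=> //; exact: Sf_Tr|left].
  by left; case: SM.
by move=> A_eq T_eq F_eq D_eq; rewrite !split_anF A_eq T_eq F_eq D_eq (extT_eq A_eq (minD_eq D_eq)).
Qed.

Lemma case_eanI : preserves cong (@Div Act) -> ~ preserves cong (@snF Act) ->
  ~ preserves cong (@aenI Act) ->
  forall L L', cong L L' <->
    [/\ alphabet L = alphabet L', Tr L = Tr L', anF L = anF L', Div L = Div L'
      & eanI L = eanI L'].
Proof.
move=> pD nS nI L L'; split.
  move=> LL'; split; [exact: AE| |exact: pres_anF|exact: pD|].
    exact: (preserves_Tr_of_Div Act_infinite cong_congr).
  exact: (preserves_eanI_of_Div Act_infinite cong_congr).
move=> [A_eq T_eq F_eq D_eq I_eq].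
have sat M : exists M1, [/\ cong M M1, alphabet M1 = alphabet M, Div M1 = Div M,
    nF M1 = [set f | [/\ ~ Div M f.1, f.2 `<=` alphabet M & Sf M f \/ extT M f.1 /\ Tr M f.1]]
    & Inf M1 = Inf M `|` [set xi | forall n, exists j, n <= j /\ Div M (prefix_of xi j)]].
  have [M1 [MM1 A1 D1 I1 F1]] := saturate_failures pD nS M.
  have [M2 [MM2 A2 D2 F2 I2]] :=
    saturate_aenI pD nI (saturate_failures_saturated A1 D1 F1).
  exists M2; split; rewrite ?A2 ?D2 ?F2 ?I2 ?D1 ?I1 //.
  exact: (cong_trans cong_congr MM1).
have [L1 [LL1 A1 D1 F1 I1]] := sat L; have [L2 [LL2 A2 D2 F2 I2]] := sat L'.
apply: (cong_saturations LL1 LL2); rewrite ?A1 ?A2 ?F1 ?F2 ?D1 ?D2 ?I1 ?I2 //.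
  exact: saturated_failures_eq.
rewrite -D_eq; apply: setU_eq_mod.
(* The saturation adds every infinite word with infinitely many divergent prefixes, so only the
   remaining part of [Inf] is still significant. *)
have eanIE M : eanI M = Inf M `\` [set xi | forall n, exists j, n <= j /\ Div M (prefix_of xi j)].
  apply/predeqP => xi; split=> -[IM h]; split=> //.
    by case: h => n nD h; have [j [nj /nD]] := h n; exact.
  apply: contrapT => nh; apply: h => n; apply: contrapT => nj; apply: nh; exists n => j nj' Dj.
  by apply: nj; exists j.
by rewrite -eanIE I_eq D_eq -eanIE.
Qed.

Lemma case_aenI : preserves cong (@Div Act) -> preserves cong (@aenI Act) ->
  ~ preserves cong (@snF Act) -> ~ preserves cong (@Inf Act) ->
  forall L L', cong L L' <->
    [/\ alphabet L = alphabet L', Tr L = Tr L', anF L = anF L', Div L = Div L'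
      & aenI L = aenI L'].
Proof.
move=> pD pA nS nI L L'; split.
  move=> LL'; split; [exact: AE| |exact: pres_anF|exact: pD|exact: pA].
  exact: (preserves_Tr_of_Div Act_infinite cong_congr).
move=> [A_eq T_eq F_eq D_eq I_eq].
have sat M : exists M1, [/\ cong M M1, alphabet M1 = alphabet M, Div M1 = Div M,
    nF M1 = [set f | [/\ ~ Div M f.1, f.2 `<=` alphabet M & Sf M f \/ extT M f.1 /\ Tr M f.1]]
    & Inf M1 = Inf M `|` [set xi | exists n, forall j, n <= j -> Div M (prefix_of xi j)]].
  have [M1 [MM1 A1 D1 I1 F1]] := saturate_failures pD nS M.
  have [M2 [MM2 A2 D2 F2 I2]] := saturate_Inf nI (saturate_failures_saturated A1 D1 F1).
  exists M2; split; rewrite ?A2 ?D2 ?F2 ?I2 ?D1 ?I1 //.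
  exact: (cong_trans cong_congr MM1).
have [L1 [LL1 A1 D1 F1 I1]] := sat L; have [L2 [LL2 A2 D2 F2 I2]] := sat L'.
apply: (cong_saturations LL1 LL2); rewrite ?A1 ?A2 ?F1 ?F2 ?D1 ?D2 ?I1 ?I2 //.
  exact: saturated_failures_eq.
rewrite -D_eq; apply: setU_eq_mod.
(* Here the added words are those with cofinitely many divergent prefixes, and the significant rest
   of [Inf] is [aenI]. *)
have aenIE M : aenI M = Inf M `\` [set xi | exists n, forall j, n <= j -> Div M (prefix_of xi j)].
  apply/predeqP => xi; split=> -[IM h]; split=> //.
    by case=> n nD; have [j [nj []]] := h n; exact: nD.
  move=> n; apply: contrapT => nj; apply: h; exists n => j nj'.
  by apply: contrapT => nDj; apply: nj; exists j.
by rewrite -aenIE I_eq D_eq -aenIE.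
Qed.

Lemma case_Div_Inf : preserves cong (@Div Act) -> preserves cong (@Inf Act) ->
  ~ preserves cong (@snF Act) ->
  forall L L', cong L L' <->
    [/\ alphabet L = alphabet L', Tr L = Tr L', anF L = anF L', Div L = Div L'
      & Inf L = Inf L'].
Proof.
move=> pD pI nS L L'; split.
  move=> LL'; split; [exact: AE| |exact: pres_anF|exact: pD|exact: pI].
  exact: (preserves_Tr_of_Div Act_infinite cong_congr).
move=> [A_eq T_eq F_eq D_eq I_eq].
have [L1 [LL1 A1 D1 I1 F1]] := saturate_failures pD nS L.
have [L2 [LL2 A2 D2 I2 F2]] := saturate_failures pD nS L'.
apply: (cong_saturations LL1 LL2); rewrite ?A1 ?A2 ?F1 ?F2 ?D1 ?D2 ?I1 ?I2 //.
exact: saturated_failures_eq.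
Qed.

End Cases.

Theorem theorem7p8 (Act : Type) (Act_infinite : infinite_set [set: Act])
    (cong : LTS Act -> LTS Act -> Prop)
    (cong_congruence : congruence cong)
    (cong_cffd : forall L L' : LTS Act, cffd_equiv L L' -> cong L L')
    (cong_VB : cong V B) :
  (preserves cong (@anF Act) -> preserves cong (@minD Act) ->
   ~ preserves cong (@Tr Act) ->
   forall L L' : LTS Act, cong L L' <->
     [/\ alphabet L = alphabet L', anF L = anF L', minD L = minD L'
       & anI L = anI L'])
  /\
  (preserves cong (@Tr Act) -> preserves cong (@anF Act) ->
   preserves cong (@minD Act) ->
   ~ preserves cong (@Div Act) -> ~ preserves cong (@Inf Act) ->
   forall L L' : LTS Act, cong L L' <->
     [/\ alphabet L = alphabet L', Tr L = Tr L', anF L = anF L',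
         minD L = minD L' & anI L = anI L'])
  /\
  (preserves cong (@anF Act) -> preserves cong (@minD Act) ->
   preserves cong (@Inf Act) ->
   ~ preserves cong (@Div Act) ->
   forall L L' : LTS Act, cong L L' <->
     [/\ alphabet L = alphabet L', Tr L = Tr L', anF L = anF L',
         minD L = minD L' & Inf L = Inf L'])
  /\
  (preserves cong (@anF Act) -> preserves cong (@Div Act) ->
   ~ preserves cong (@snF Act) -> ~ preserves cong (@aenI Act) ->
   forall L L' : LTS Act, cong L L' <->
     [/\ alphabet L = alphabet L', Tr L = Tr L', anF L = anF L',
         Div L = Div L' & eanI L = eanI L'])
  /\
  (preserves cong (@anF Act) -> preserves cong (@Div Act) ->
   preserves cong (@aenI Act) ->
   ~ preserves cong (@snF Act) -> ~ preserves cong (@Inf Act) ->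
   forall L L' : LTS Act, cong L L' <->
     [/\ alphabet L = alphabet L', Tr L = Tr L', anF L = anF L',
         Div L = Div L' & aenI L = aenI L'])
  /\
  (preserves cong (@anF Act) -> preserves cong (@Div Act) ->
   preserves cong (@Inf Act) ->
   ~ preserves cong (@snF Act) ->
   forall L L' : LTS Act, cong L L' <->
     [/\ alphabet L = alphabet L', Tr L = Tr L', anF L = anF L',
         Div L = Div L' & Inf L = Inf L']).
Proof.
split; first by move=> pF; exact: case_chaos.
split; first by move=> pT pF; exact: case_Tr_anI.
split; first by move=> pF; exact: case_minD_Inf.
split; first by move=> pF; exact: case_eanI.
split; first by move=> pF; exact: case_aenI.
by move=> pF; exact: case_Div_Inf.
Qed.
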